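(* If $\min\{r',s'\}<\min\{r,s\}$, then every local orthogonal map $F:U\to\mathbb P^{r',s',t'}$, with $U\subset\mathbb P^{r,s,t}$ a connected open set containing a null point, is null, i.e. $F(U)$ is contained in a null space of $\mathbb P^{r',s',t'}$.
   Context: Let $r,s,t\ge 0$ be integers with $n=r+s+t>0$. $\mathbb C^{r,s,t}$ denotes $\mathbb C^n$ equipped with the Hermitian form $\langle z,w\rangle_{r,s,t}=\sum_{j=1}^{r}z_j\bar w_j-\sum_{j=r+1}^{r+s}z_j\bar w_j$, and $\mathbb P^{r,s,t}$ is its projectivization. A point $[z]$ is null if $\langle z,z\rangle_{r,s,t}=0$; $[z]\perp[w]$ if $\langle z,w\rangle_{r,s,t}=0$. A projective linear subspace $\mathbb PH$ is a null space if the form vanishes identically on $H$. A holomorphic map $F:U\to\mathbb P^{r',s',t'}$ on a connected open set $U\subset\mathbb P^{r,s,t}$ containing a null point is a local orthogonal map if $F(p)\perp F(q)$ for all $p,q\in U$ with $p\perp q$. *)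

(* Defs.v *)
From HB Require Import structures.
From mathcomp Require Import all_boot all_order all_algebra all_field.
From mathcomp Require Import complex.
From mathcomp Require Import all_classical all_reals all_analysis.
Import Order.TTheory GRing.Theory Num.Theory.
Import numFieldNormedType.Exports.

Set Implicit Arguments.
Unset Strict Implicit.
Unset Printing Implicit Defensive.

Local Open Scope ring_scope.
Local Open Scope classical_set_scope.

Definition Cplx (R : realType) : numClosedFieldType := R[i].

(* Homogeneous coordinates: C^n = 'rV[Cplx R]_n; a point of the projective
   space P(C^n) is represented by a nonzero vector, [z] = [w] iff z, w are
   proportional. *)

Definition hform (R : realType) (r s t : nat) (z w : 'rV[Cplx R]_(r + s + t))
  : Cplx R :=
  \sum_(j < r + s + t | (j < r)%N) z ord0 j * (w ord0 j)^*
  - \sum_(j < r + s + t | (r <= j < r + s)%N) z ord0 j * (w ord0 j)^*.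

Definition null_vec (R : realType) (r s t : nat) (z : 'rV[Cplx R]_(r + s + t)) :=
  z != 0 /\ hform z z = 0.

(* An open subset U of P^{r,s,t}, described by its cone
   Ut = pi^{-1}(U) in C^n \ {0} (pi : C^n \ {0} -> P the projection);
   U open (resp. connected) iff Ut is open (resp. connected). *)
Definition proj_cone (R : realType) (n : nat) (Ut : set 'rV[Cplx R]_n) :=
  (forall z, Ut z -> z != 0) /\
  (forall z (l : Cplx R), Ut z -> l != 0 -> Ut (l *: z)).

(* A map F : U -> P(C^n'), given on homogeneous coordinates by
   f : Ut -> C^n' \ {0}, compatible with the projection:
   F([z]) = [f z], well defined on projective points. *)
Definition proj_map (R : realType) (n n' : nat) (Ut : set 'rV[Cplx R]_n)
  (f : 'rV[Cplx R]_n -> 'rV[Cplx R]_n') :=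
  (forall z, Ut z -> f z != 0) /\
  (forall z (l : Cplx R), Ut z -> l != 0 ->
      exists mu : Cplx R, f (l *: z) = mu *: f z).

(* F is holomorphic: F o pi is locally given in homogeneous coordinates by a
   nonvanishing holomorphic (complex-Frechet-differentiable) map. *)
Definition proj_holomorphic (R : realType) (n n' : nat)
  (Ut : set 'rV[Cplx R]_n) (f : 'rV[Cplx R]_n -> 'rV[Cplx R]_n') :=
  forall z, Ut z ->
    exists (W : set 'rV[Cplx R]_n) (G : 'rV[Cplx R]_n -> 'rV[Cplx R]_n'),
      [/\ open W, W z &
          forall w, W w -> Ut w ->
            [/\ differentiable G w, G w != 0 &
                exists mu : Cplx R, f w = mu *: G w]].

Definition local_orthogonal (R : realType) (r s t r' s' t' : nat)
  (Ut : set 'rV[Cplx R]_(r + s + t))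
  (f : 'rV[Cplx R]_(r + s + t) -> 'rV[Cplx R]_(r' + s' + t')) :=
  forall z w, Ut z -> Ut w -> hform z w = 0 -> hform (f z) (f w) = 0.

Definition null_subspace (R : realType) (r s t : nat)
  (H : {vspace 'rV[Cplx R]_(r + s + t)}) :=
  forall x y, x \in H -> y \in H -> hform x y = 0.

Definition null_map (R : realType) (r s t r' s' t' : nat)
  (Ut : set 'rV[Cplx R]_(r + s + t))
  (f : 'rV[Cplx R]_(r + s + t) -> 'rV[Cplx R]_(r' + s' + t')) :=
  exists H : {vspace 'rV[Cplx R]_(r' + s' + t')},
    null_subspace H /\ forall z, Ut z -> f z \in H.

(* Main.v *)
Require Import Defs.
From HB Require Import structures.
From mathcomp Require Import all_boot all_order all_algebra all_field.
From mathcomp Require Import complex.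
From mathcomp Require Import all_classical all_reals all_analysis.
From mathcomp Require Import ring lra zify.
Import Order.TTheory GRing.Theory Num.Theory.
Import numFieldNormedType.Exports.
Import ComplexField.Normc.

(* Work in a ball around a null point, where the map is given by a single
   holomorphic G. If every null point of the ball is sent to a null subspace L
   (at the start, the radical of the target form), then so is the whole ball,
   since a holomorphic function vanishing on the null cone near a non-radical
   point vanishes. Otherwise G q lies outside L for all null points q in some open
   set. Restrict G to the orthogonal of q and enlarge L by G q; since
   dim L <= min(r', s') + t', this stops before min(r, s) steps, and by induction
   G is null on the orthogonal of q. Letting q vary, G z is orthogonal to G w for
   null z near q and arbitrary w, hence for all z and w.
   Both uniqueness principles (from an open set, from the null cone) reduce to one
   complex variable: a holomorphic function on a neighbourhood of a square that
   vanishes on one side of it vanishes at its centre. *)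

Set Implicit Arguments.
Unset Strict Implicit.
Unset Printing Implicit Defensive.

Local Open Scope ring_scope.
Local Open Scope classical_set_scope.
Local Notation Re := (@complex.Re _).
Local Notation Im := (@complex.Im _).

(** * Goursat's lemma for midpoint sums *)

(** The null cone is a real hypersurface, so the identity theorem for open sets does not apply to it
    directly. A complex line in a suitable null direction meets it in a real line, and a side of a
    square lies on such a line: this dictates the one-variable statement. Cauchy's formula is needed
    only at the centre of a square and only up to a nonzero factor, so midpoint sums replace
    integrals and [2 * pi] is never computed. As [hform] is conjugate-linear in its second argument,
    [hform (G z) (G w)] is holomorphic in [z] alone: each extension moves one argument, and the
    other one follows by Hermitian symmetry. The strict inequality of signatures keeps the number of
    points [q] below [minn r s], so that their common orthogonal still contains two null vectors
    with nonzero product. These serve to perturb a null point out of the radical and to find null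
    points orthogonal to a given one. *)

Section Goursat.
Local Open Scope complex_scope.
Variable R : realType.
Implicit Types (k : R[i] -> R[i]) (a b c v z w : R[i]) (l t e d M : R).

Definition on_segment (P : R[i] -> Prop) a v :=
  forall t, 0 <= t <= 1 -> P (a + t%:C * v).

(* Midpoint sums over [2 ^ j] pieces of the segment from [a] to [a + v] replace
   path integrals: they are exact on affine functions and exactly additive under
   the subdivision of squares, which is all that Goursat's bisection needs. *)
Fixpoint midsum (j : nat) k a v : R[i] :=
  if j is j'.+1 then midsum j' k a (v / 2) + midsum j' k (a + v / 2) (v / 2)
  else k (a + v / 2) * v.

Lemma on_segment_lhalf P a v : on_segment P a v -> on_segment P a (v / 2).
Proof.
move=> h t /andP[t0 t1].
have -> : a + t%:C * (v / 2) = a + (t / 2)%:C * v.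
  by rewrite rmorphM fmorphV /= rmorph_nat; ring.
by apply: h; lra.
Qed.

Lemma on_segment_rhalf P a v :
  on_segment P a v -> on_segment P (a + v / 2) (v / 2).
Proof.
move=> h t /andP[t0 t1].
have -> : a + v / 2 + t%:C * (v / 2) = a + ((1 + t) / 2)%:C * v.
  by rewrite rmorphM fmorphV /= rmorphD rmorph_nat rmorph1; ring.
by apply: h; lra.
Qed.

Lemma on_segment_mid P a v : on_segment P a v -> P (a + v / 2).
Proof.
have -> : a + v / 2 = a + (1 / 2)%:C * v.
  by rewrite rmorphM fmorphV /= rmorph_nat rmorph1; ring.
by apply; lra.
Qed.

Lemma midsum_rev j k a v : midsum j k (a + v) (- v) = - midsum j k a v.
Proof.
elim: j a v => [|j IH] a v /=; first by rewrite mulrN; congr (- (k _ * _)); field.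
have -> : a + v + - v / 2 = a + v / 2 by field.
have {1}-> : a + v = a + v / 2 + v / 2 by field.
by rewrite mulNr !IH; ring.
Qed.

Lemma eq_msum j k k' a v : on_segment (fun z => k z = k' z) a v ->
  midsum j k a v = midsum j k' a v.
Proof.
elim: j a v => [|j IH] a v h /=; first by rewrite (on_segment_mid h).
by rewrite (IH _ _ (on_segment_lhalf h)) (IH _ _ (on_segment_rhalf h)).
Qed.

Lemma midsumD j k k' a v :
  midsum j (fun z => k z + k' z) a v = midsum j k a v + midsum j k' a v.
Proof. by elim: j a v => [|j IH] a v /=; rewrite ?IH; ring. Qed.

Lemma midsumZ j k b a v : midsum j (fun z => b * k z) a v = b * midsum j k a v.
Proof. by elim: j a v => [|j IH] a v /=; rewrite ?IH; ring. Qed.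

Lemma midsum_affine j b c a v :
  midsum j (fun z => b * z + c) a v = (b * (a + v / 2) + c) * v.
Proof. by elim: j a v => [|j IH] a v //=; rewrite !IH; field. Qed.

Lemma normc_real (x : R) : normc x%:C = `|x|.
Proof. by rewrite /= expr0n addr0 sqrtr_sqr. Qed.

Lemma normc_nat n : normc (n%:R : R[i]) = n%:R.
Proof. by rewrite -(rmorph_nat (real_complex R)) normc_real ger0_norm. Qed.

Lemma normc_i : normc ('i : R[i]) = 1.
Proof. by rewrite /= expr0n add0r expr1n sqrtr1. Qed.

Lemma normc_half v : normc (v / 2) = normc v / 2.
Proof. by rewrite normcM normcV normc_nat. Qed.

Lemma normc_ge0 v : 0 <= normc v.
Proof. by case: v => x y /=; rewrite sqrtr_ge0. Qed.

Lemma midsum_bound j k a v M : on_segment (fun z => normc (k z) <= M) a v ->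
  normc (midsum j k a v) <= M * normc v.
Proof.
elim: j a v => [|j IH] a v h /=.
  by rewrite normcM ler_wpM2r ?normc_ge0// (on_segment_mid h).
apply: le_trans (le_normcD _ _) _.
have := IH _ _ (on_segment_lhalf h); have := IH _ _ (on_segment_rhalf h).
rewrite normc_half; lra.
Qed.

(** Meant for the sums of [z^-1], in place of a winding number. The increment is a real length [l]
    times a fixed direction [b], so that the bound on [k z * b] is unchanged by halving. *)
Lemma midsum_Im_bound j k a b l (m : R) : 0 <= l ->
  on_segment (fun z => m <= Im (k z * b)) a (l%:C * b) ->
  m * l <= Im (midsum j k a (l%:C * b)).
Proof.
elim: j a l => [|j IH] a l l0 h /=.
  have := on_segment_mid h => {}h.
  rewrite mulrCA.
  move: h; case: (k _ * b) => x y /=.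
  by rewrite mul0r addr0 mulrC => h; rewrite ler_wpM2l.
have E : l%:C * b / 2 = (l / 2)%:C * b.
  by rewrite rmorphM fmorphV /= rmorph_nat; ring.
have := on_segment_lhalf h; have := on_segment_rhalf h.
rewrite E => /IH h2 /IH h1.
have := h1 ltac:(lra); have := h2 ltac:(lra).
rewrite raddfD /=; lra.
Qed.

Lemma le_normcD4 a b c v :
  normc (a + b + c + v) <= normc a + normc b + normc c + normc v.
Proof. by do 2 (apply: le_trans (le_normcD _ _) _; rewrite lerD2r); exact: le_normcD. Qed.

(** Stands for the contour integral around the square of centre [c] and half-side [l],
    counterclockwise from the lower left corner. *)
Definition sqsum j k c l : R[i] :=
  midsum j k (c - l%:C - 'i * l%:C) (2 * l%:C)
  + midsum j k (c + l%:C - 'i * l%:C) (2 * 'i * l%:C)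
  + midsum j k (c + l%:C + 'i * l%:C) (- (2 * l%:C))
  + midsum j k (c - l%:C + 'i * l%:C) (- (2 * 'i * l%:C)).

Definition in_square c l z := `|Re (z - c)| <= l /\ `|Im (z - c)| <= l.

(** Each inner edge is run in opposite directions by two neighbouring quarters and cancels. Halving
    the outer edges uses up one level of depth. *)
Lemma sqsumS j k c l : let h := (l / 2)%:C in
  sqsum j.+1 k c l =
  sqsum j k (c - h - 'i * h) (l / 2) + sqsum j k (c + h - 'i * h) (l / 2)
  + sqsum j k (c + h + 'i * h) (l / 2) + sqsum j k (c - h + 'i * h) (l / 2).
Proof.
(* Starting points are written in units of [h] from the centre, which reduces the cancellation to
   matching lattice points. *)
move=> h; pose T x y v := midsum j k (c + x * h + y * ('i * h)) v.
have child x y : sqsum j k (c + x * h + y * ('i * h)) (l / 2) =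
    T (x - 1) (y - 1) (2 * h) + T (x + 1) (y - 1) (2 * 'i * h)
    + T (x + 1) (y + 1) (- (2 * h)) + T (x - 1) (y + 1) (- (2 * 'i * h)).
  by rewrite /sqsum -/h /T;
    congr (midsum _ _ _ _ + midsum _ _ _ _ + midsum _ _ _ _ + midsum _ _ _ _); ring.
have revh x y : T (x + 2) y (- (2 * h)) = - T x y (2 * h).
  by rewrite /T -midsum_rev; congr midsum; ring.
have revv x y : T x (y + 2) (- (2 * 'i * h)) = - T x y (2 * 'i * h).
  by rewrite /T -midsum_rev; congr midsum; ring.
have -> : c - h - 'i * h = c + (-1) * h + (-1) * ('i * h) by ring.
have -> : c + h - 'i * h = c + 1 * h + (-1) * ('i * h) by ring.
have -> : c + h + 'i * h = c + 1 * h + 1 * ('i * h) by ring.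
have -> : c - h + 'i * h = c + (-1) * h + 1 * ('i * h) by ring.
rewrite !child !subrr !addNr.
have E : l%:C = 2 * h.
  by rewrite /h rmorphM fmorphV /= rmorph_nat; field.
have big : sqsum j.+1 k c l =
    T (-1 - 1) (-1 - 1) (2 * h) + T 0 (-1 - 1) (2 * h)
  + (T (1 + 1) (-1 - 1) (2 * 'i * h) + T (1 + 1) 0 (2 * 'i * h))
  + (T (1 + 1) (1 + 1) (- (2 * h)) + T 0 (1 + 1) (- (2 * h)))
  + (T (-1 - 1) (1 + 1) (- (2 * 'i * h)) + T (-1 - 1) 0 (- (2 * 'i * h))).
  rewrite /sqsum /= E /T.
  congr (midsum _ _ _ _ + midsum _ _ _ _ + (midsum _ _ _ _ + midsum _ _ _ _)
    + (midsum _ _ _ _ + midsum _ _ _ _) + (midsum _ _ _ _ + midsum _ _ _ _)); by field.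
rewrite big.
have e1 : T 0 0 (- (2 * h)) = - T (-1 - 1) 0 (2 * h).
  by rewrite -revh; congr T; ring.
have e2 : T (1 + 1) 0 (- (2 * h)) = - T 0 0 (2 * h).
  by rewrite -revh; congr T; ring.
have e3 : T 0 0 (- (2 * 'i * h)) = - T 0 (-1 - 1) (2 * 'i * h).
  by rewrite -revv; congr T; ring.
have e4 : T 0 (1 + 1) (- (2 * 'i * h)) = - T 0 0 (2 * 'i * h).
  by rewrite -revv; congr T; ring.
by rewrite e1 e2 e3 e4; ring.
Qed.

Definition cdiff k z := exists a, forall e, 0 < e -> exists2 d, 0 < d &
  forall y, normc (y - z) < d ->
    normc (k y - k z - a * (y - z)) <= e * normc (y - z).

Lemma normc_le_ReIm z : normc z <= `|Re z| + `|Im z|.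
Proof.
case: z => x y /=; rewrite -[leRHS]ger0_norm ?addr_ge0// -sqrtr_sqr ler_wsqrtr//.
rewrite sqrrD !real_normK ?num_real//.
by have := mulr_ge0 (normr_ge0 x) (normr_ge0 y); rewrite mulr2n; lra.
Qed.

Lemma Im_le_normc z : `|Im z| <= normc z.
Proof. by case: z => x y /=; rewrite -sqrtr_sqr ler_wsqrtr// lerDr sqr_ge0. Qed.

Lemma in_square_edges (P : R[i] -> Prop) c l : 0 < l ->
  (forall z, in_square c l z -> P z) ->
  [/\ on_segment P (c - l%:C - 'i * l%:C) (2 * l%:C),
      on_segment P (c + l%:C - 'i * l%:C) (2 * 'i * l%:C),
      on_segment P (c + l%:C + 'i * l%:C) (- (2 * l%:C)) &
      on_segment P (c - l%:C + 'i * l%:C) (- (2 * 'i * l%:C))].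
Proof.
move=> l0 h; case: c h => cx cy h.
by split=> t /andP[t0 t1]; apply: h; split; simpc => /=; rewrite ler_norml; nra.
Qed.

Lemma sqsum_bound j k c l M : 0 < l ->
  (forall z, in_square c l z -> normc (k z) <= M) ->
  normc (sqsum j k c l) <= 8 * l * M.
Proof.
move=> l0 /(in_square_edges l0) [/midsum_bound h1 /midsum_bound h2
  /midsum_bound h3 /midsum_bound h4].
have E1 : normc (2 * l%:C) = 2 * l by rewrite normcM normc_nat normc_real gtr0_norm.
have E2 : normc (2 * 'i * l%:C) = 2 * l by rewrite -mulrA mulrCA normcM E1 normc_i mul1r.
rewrite /sqsum; apply: le_trans (le_normcD4 _ _ _ _) _.
have := h1 j; have := h2 j; have := h3 j; have := h4 j.
rewrite !normcN E1 E2; lra.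
Qed.

Lemma sqsum_affine j b a c l : sqsum j (fun z => b * z + a) c l = 0.
Proof.
by rewrite /sqsum !midsum_affine; field.
Qed.

Lemma sqsumD j k k' c l :
  sqsum j (fun z => k z + k' z) c l = sqsum j k c l + sqsum j k' c l.
Proof. by rewrite /sqsum !midsumD; ring. Qed.

Lemma cdiff_sqsum k z : cdiff k z -> forall e, 0 < e -> exists2 d, 0 < d &
  forall c l, 0 < l < d -> in_square c l z -> forall j,
    normc (sqsum j k c l) <= e * l ^+ 2.
Proof.
(* Perimeter [8 * l] times distance at most [4 * l] gives the factor 32; the radius [d / 8] ensures
   [4 * l < d]. *)
move=> [a ka] e e0; have [|d d0 h] := ka (e / 32); first lra.
exists (d / 8); first lra.
move=> c l /andP[l0 ld] [zr zi] j.
pose k' y := k y - k z - a * (y - z).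
have -> : k = fun y => (a * y + (k z - a * z)) + k' y.
  by apply/funext => y; rewrite /k'; ring.
rewrite sqsumD sqsum_affine add0r.
have -> : e * l ^+ 2 = 8 * l * (e / 32 * (4 * l)) by field.
apply: sqsum_bound => // y [yr yi].
have N4 : normc (y - z) <= 4 * l.
  apply: le_trans (normc_le_ReIm _) _.
  have -> : Re (y - z) = Re (y - c) - Re (z - c).
    by case: (y) (z) (c) => ? ? [? ?] [? ?] /=; ring.
  have -> : Im (y - z) = Im (y - c) - Im (z - c).
    by case: (y) (z) (c) => ? ? [? ?] [? ?] /=; ring.
  have := ler_normB (Re (y - c)) (Re (z - c)).
  have := ler_normB (Im (y - c)) (Im (z - c)); lra.
apply: le_trans (h _ _) _; first lra.
by rewrite ler_wpM2l//; lra.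
Qed.

(** The intervals [[lo n, hi n]] are nested, and the supremum of their left ends lies in all of
    them. The error is the half-side of the [n]-th square, so the limit of the centres stays in
    every square of the bisection. *)
Lemma geometric_limit (x : nat -> R) l :
  (forall n, `|x n.+1 - x n| <= l / 2 ^+ n.+1) ->
  exists y, forall n, `|y - x n| <= l / 2 ^+ n.
Proof.
move=> h.
have l0 : 0 <= l.
  by have := le_trans (normr_ge0 _) (h 0%N); rewrite expr1; lra.
have half n : l / 2 ^+ n = 2 * (l / 2 ^+ n.+1).
  by rewrite exprSr invfM [l * (_ * _)]mulrA; move: (l / _) => q; field.
pose lo n := x n - l / 2 ^+ n; pose hi n := x n + l / 2 ^+ n.
have lohi n : lo n <= lo n.+1 /\ hi n.+1 <= hi n.
  by have := h n; rewrite ler_norml /lo /hi (half n) => /andP[]; split; lra.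
have lole m n : (m <= n)%N -> lo m <= lo n.
  by move=> /subnK <-; elim: (_ - _)%N => // i IH; exact: le_trans IH (lohi _).1.
have hile m n : (m <= n)%N -> hi n <= hi m.
  by move=> /subnK <-; elim: (_ - _)%N => // i IH; exact: le_trans (lohi _).2 IH.
have lh m n : lo m <= hi n.
  apply: le_trans (lole _ _ (leq_maxl m n)) (le_trans _ (hile _ _ (leq_maxr m n))).
  have : 0 <= l / 2 ^+ maxn m n by rewrite divr_ge0// exprn_ge0.
  by rewrite /lo /hi; lra.
have hs : has_sup (range lo).
  by split; [exists (lo 0%N), 0%N | exists (hi 0%N) => _ [n _ <-]; exact: lh].
exists (sup (range lo)) => n; rewrite ler_distl; apply/andP; split.
  by apply: ub_le_sup; [case: hs | exists n].
by apply: ge_sup; [case: hs | move=> _ [m _ <-]; exact: lh].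
Qed.

(** Goursat's bisection: [e * h ^+ 2] is additive over quarters, so a bad square has a bad quarter,
    and nested bad squares contradict [cdiff_sqsum] at their common point. *)
Lemma sqsum_small k c l : 0 < l -> (forall z, in_square c l z -> cdiff k z) ->
  forall e, 0 < e ->
  exists n, forall j, (n <= j)%N -> normc (sqsum j k c l) <= e * l ^+ 2.
Proof.
move=> l0 kd e e0; apply: contrapT => bad0.
pose good b h := exists n, forall j, (n <= j)%N ->
  normc (sqsum j k b h) <= e * h ^+ 2.
(* The hypotheses stand under the existential so that [choice] yields a total function. *)
have step b h : exists b', 0 < h -> ~ good b h ->
    [/\ `|Re b' - Re b| <= h / 2, `|Im b' - Im b| <= h / 2 & ~ good b' (h / 2)].
  have [h0|hn] := ltP 0 h; last by exists b.
  have [gb|bad] := pselect (good b h); first by exists b.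
  pose g := (h / 2)%:C.
  have [g1|b1] := pselect (good (b - g - 'i * g) (h / 2)); last first.
    by exists (b - g - 'i * g) => _ _; split => //; rewrite /g; case: (b) => x y; simpc => /=;
      rewrite ler_norml; lra.
  have [g2|b2] := pselect (good (b + g - 'i * g) (h / 2)); last first.
    by exists (b + g - 'i * g) => _ _; split => //; rewrite /g; case: (b) => x y; simpc => /=;
      rewrite ler_norml; lra.
  have [g3|b3] := pselect (good (b + g + 'i * g) (h / 2)); last first.
    by exists (b + g + 'i * g) => _ _; split => //; rewrite /g; case: (b) => x y; simpc => /=;
      rewrite ler_norml; lra.
  have [g4|b4] := pselect (good (b - g + 'i * g) (h / 2)); last first.
    by exists (b - g + 'i * g) => _ _; split => //; rewrite /g; case: (b) => x y; simpc => /=;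
      rewrite ler_norml; lra.
  exfalso; apply: bad.
  case: g1 g2 g3 g4 => [n1 g1] [n2 g2] [n3 g3] [n4 g4].
  exists (n1 + n2 + n3 + n4).+1 => -[//|j] jn; rewrite sqsumS -/g.
  have := g1 j ltac:(lia); have := g2 j ltac:(lia).
  have := g3 j ltac:(lia); have := g4 j ltac:(lia).
  have -> : e * h ^+ 2 = e * (h / 2) ^+ 2 + e * (h / 2) ^+ 2 + e * (h / 2) ^+ 2 + e * (h / 2) ^+ 2 by field.
  by move=> *; apply: le_trans (le_normcD4 _ _ _ _) _; rewrite !lerD.
have [nxt nxtP] := choice (fun bh => step bh.1 bh.2).
pose u := fix u n := if n is n'.+1 then nxt (u n', l / 2 ^+ n') else c.
have hl n : 0 < l / 2 ^+ n by rewrite divr_gt0// exprn_gt0.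
have lS n : l / 2 ^+ n.+1 = l / 2 ^+ n / 2 by rewrite exprSr invfM mulrA.
have ubad n : ~ good (u n) (l / 2 ^+ n).
  elim: n => [|n IH]; first by rewrite expr0 divr1.
  by rewrite lS; case: (nxtP (u n, l / 2 ^+ n) (hl n) IH).
have [|X hX] := @geometric_limit (fun n => Re (u n)) l.
  by move=> n; rewrite lS; case: (nxtP (u n, l / 2 ^+ n) (hl n) (ubad n)).
have [|Y hY] := @geometric_limit (fun n => Im (u n)) l.
  by move=> n; rewrite lS; case: (nxtP (u n, l / 2 ^+ n) (hl n) (ubad n)).
have zin n : in_square (u n) (l / 2 ^+ n) (X +i* Y).
  by have := hX n; have := hY n; rewrite /in_square; case: (u n) => x y.
have := zin 0%N; rewrite expr0 divr1 => /kd /cdiff_sqsum /(_ e e0) [d d0 hd].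
have [n ln] : exists n, l / 2 ^+ n < d.
  exists (Num.truncn (l / d)).+1; rewrite ltr_pdivrMr ?exprn_gt0// mulrC -ltr_pdivrMr//.
  apply: lt_trans (truncnS_gt _) _; rewrite -natrX ltr_nat.
  exact: ltn_expl.
apply: (ubad n); exists 0%N => j _; apply: hd; last exact: zin.
by rewrite hl.
Qed.
End Goursat.

(** * Goursat's lemma with an exceptional point at the centre *)

Section PuncturedGoursat.
Local Open Scope complex_scope.
Variable R : realType.
Local Notation K := (Cplx R).
Implicit Types (k psi : K -> K) (l e M : R).

Lemma norm_normc (z : K) : `|z| = (normc z)%:C.
Proof. by []. Qed.

Lemma pos_complexE (e : K) : 0 < e -> exists2 d : R, 0 < d & e = d%:C.
Proof.
by case: e => x y; rewrite ltcE /= => /andP[/eqP -> x0]; exists x.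
Qed.

Lemma derivable_cdiff k z : derivable (k : K^o -> K^o) z 1 -> cdiff k z.
Proof.
move=> /cvg_ex [a ka]; exists a => e e0.
have e0' : 0 < e%:C :> K by rewrite ltcR.
move/cvgrPdist_le: ka => /(_ _ e0'); rewrite near_withinE /=.
move=> /(@nbhs_norm0P K K^o)[_ /= /pos_complexE[d d0 ->] h].
exists d => // y yd.
have [->|yz] := eqVneq y z.
  by rewrite !subrr mulr0 subr0 normc0 mulr0.
have yz0 : y - z != 0 by rewrite subr_eq0.
have := h (y - z); rewrite /= norm_normc ltcR => /(_ yd yz0).
rewrite /GRing.scale /= mulr1 subrK norm_normc lecR => hle.
have -> : k y - k z - a * (y - z) = - (a - (y - z)^-1 * (k y - k z)) * (y - z).
  by field.
by rewrite normcM normcN ler_wpM2r ?normc_ge0.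
Qed.

(** Two subdivisions give sixteen squares. The four that touch the origin reassemble into the square
    of half-side [l / 2]; the other twelve have a centre with a coordinate [3] or [-3] in units of
    [h], and avoid the origin. *)
Lemma sqsum_center k l : 0 < l -> exists s : seq K,
  (forall p, p \in s -> forall z, in_square p (l / 2 / 2) z ->
     z != 0 /\ in_square 0 l z) /\
  forall j, sqsum j.+2 k 0 l =
    sqsum j.+1 k 0 (l / 2) + \sum_(p <- s) sqsum j k p (l / 2 / 2).
Proof.
move=> l0; pose h : K := (l / 2 / 2)%:C; pose P (x y : K) := x * h + y * ('i * h).
exists [:: P (-3) (-3); P (-1) (-3); P 1 (-3); P 3 (-3);
           P (-3) (-1); P 3 (-1); P (-3) 1; P 3 1;
           P (-3) 3; P (-1) 3; P 1 3; P 3 3].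
split=> [p hp [u v]|j].
  have E (x y : R) : P x%:C y%:C = (x * (l / 2 / 2)) +i* (y * (l / 2 / 2)).
    by rewrite /P /h; simpc.
  have e3 : (3 : K) = (3 : R)%:C by rewrite rmorph_nat.
  have e1 : (1 : K) = (1 : R)%:C by rewrite rmorph1.
  have {hp} : exists2 xy : R * R, p = (xy.1 * (l / 2 / 2)) +i* (xy.2 * (l / 2 / 2)) &
     [/\ -3 <= xy.1 <= 3, -3 <= xy.2 <= 3 &
       [\/ xy.1 = 3, xy.1 = -3, xy.2 = 3 | xy.2 = -3]].
    have box (x y : R) : -3 <= x <= 3 -> -3 <= y <= 3 ->
        [\/ x = 3, x = -3, y = 3 | y = -3] ->
        exists2 xy : R * R, P x%:C y%:C = (xy.1 * (l / 2 / 2)) +i* (xy.2 * (l / 2 / 2)) &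
        [/\ -3 <= xy.1 <= 3, -3 <= xy.2 <= 3 &
          [\/ xy.1 = 3, xy.1 = -3, xy.2 = 3 | xy.2 = -3]].
      by move=> *; exists (x, y).
    move: hp; rewrite !inE e3 e1 -!rmorphN /=.
    by repeat (case/orP => [/eqP ->|]); try move/eqP ->; apply: box;
      first [lra | by constructor 1 | by constructor 2 | by constructor 3 | by constructor 4].
  move=> [[x y] /= -> [xb yb xy]] [/= hu hv].
  split; last by split; rewrite /= ler_norml; move: hu hv; rewrite !ler_norml; nra.
  rewrite eq_complex /= negb_and; move: hu hv; rewrite !ler_norml => hu hv.
  case: xy => xy; apply/orP; [left|left|right|right];
    apply/eqP => z0; move: hu hv; rewrite z0 xy; lra.
pose T x y := sqsum j k (P x y) (l / 2 / 2).
have child x y : sqsum j.+1 k (P x y) (l / 2) =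
    T (x - 1) (y - 1) + T (x + 1) (y - 1) + T (x + 1) (y + 1) + T (x - 1) (y + 1).
  by rewrite sqsumS -/h /T /P;
    congr (sqsum _ _ _ _ + sqsum _ _ _ _ + sqsum _ _ _ _ + sqsum _ _ _ _); ring.
have hh : (l / 2)%:C = 2 * h.
  by rewrite /h [in RHS]rmorphM fmorphV /= rmorph_nat; field.
rewrite sqsumS hh.
have -> : 0 - 2 * h - 'i * (2 * h) = P (-2) (-2) by rewrite /P; ring.
have -> : 0 + 2 * h - 'i * (2 * h) = P 2 (-2) by rewrite /P; ring.
have -> : 0 + 2 * h + 'i * (2 * h) = P 2 2 by rewrite /P; ring.
have -> : 0 - 2 * h + 'i * (2 * h) = P (-2) 2 by rewrite /P; ring.
have -> : sqsum j.+1 k 0 (l / 2) = sqsum j.+1 k (P 0 0) (l / 2).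
  by congr sqsum; rewrite /P; ring.
rewrite !child !big_cons big_nil -!/(T _ _).
have -> : -2 - 1 = -3 :> K by ring.
have -> : -2 + 1 = -1 :> K by ring.
have -> : 2 - 1 = 1 :> K by ring.
have -> : 2 + 1 = 3 :> K by ring.
rewrite !sub0r !add0r; ring.
Qed.

Lemma sqsum_seq_small k (s : seq K) l : 0 < l ->
  (forall p, p \in s -> forall z, in_square p l z -> cdiff k z) ->
  forall e, 0 < e -> exists n, forall j, (n <= j)%N ->
    normc (\sum_(p <- s) sqsum j k p l) <= e.
Proof.
move=> l0; elim: s => [|p s IH] ks e e0.
  by exists 0%N => j _; rewrite big_nil normc0 ltW.
have ks' q : q \in s -> forall z, in_square q l z -> cdiff k z.
  by move=> qs; apply: ks; rewrite inE qs orbT.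
have e20 : 0 < e / 2 by lra.
have [n1 h1] := IH ks' _ e20.
have e1 : 0 < e / 2 / l ^+ 2 by rewrite divr_gt0 ?exprn_gt0.
have ksp := ks p (mem_head _ _).
have [n2 h2] := sqsum_small l0 ksp e1.
exists (n1 + n2)%N => j nj; rewrite big_cons; apply: le_trans (le_normcD _ _) _.
have := h1 j ltac:(lia); have := h2 j ltac:(lia).
by rewrite divfK ?expf_neq0 ?gt_eqF//; lra.
Qed.

(** Near the origin only boundedness is used: after [n] passages to the central square, perimeter
    times [M] is at most [e / 2], and each ring removed on the way contributes as little as desired
    by Goursat. *)
Lemma sqsum_small_punctured k l M d : 0 < l -> 0 < d ->
  (forall z, in_square 0 l z -> z != 0 -> cdiff k z) ->
  (forall z, in_square 0 d z -> normc (k z) <= M) ->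
  forall e, 0 < e -> exists n, forall j, (n <= j)%N -> normc (sqsum j k 0 l) <= e.
Proof.
move=> l0 d0 kd kM e e0.
have M0 : 0 <= M.
  by apply: le_trans (kM 0 _); rewrite ?normc_ge0// /in_square subrr /= normr0 ltW.
have hl n : 0 < l / 2 ^+ n by rewrite divr_gt0// exprn_gt0.
have [n [nd ne]] : exists n, l / 2 ^+ n < d /\ 8 * (l / 2 ^+ n) * M <= e / 2.
  pose N := (Num.truncn (l / d) + Num.truncn (16 * l * M / e)).+1.
  have N2 : (N%:R : R) < 2 ^+ N by rewrite -natrX ltr_nat ltn_expl.
  have h1 : l / d < 2 ^+ N.
    apply: lt_trans N2; apply: lt_le_trans (truncnS_gt _) _.
    by rewrite ler_nat ltnS leq_addr.
  have h2 : 16 * l * M / e < 2 ^+ N.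
    apply: lt_trans N2; apply: lt_le_trans (truncnS_gt _) _.
    by rewrite ler_nat ltnS leq_addl.
  exists N; split; first by rewrite ltr_pdivrMr ?exprn_gt0// mulrC -ltr_pdivrMr.
  have := h2; rewrite ltr_pdivrMr// => h3.
  have -> : 8 * (l / 2 ^+ N) * M = (8 * l * M) / 2 ^+ N by ring.
  by rewrite ler_pdivrMr ?exprn_gt0//; lra.
(* Induction from the innermost square outwards; [e'] is quantified inside so that each new ring can
   take half of it. *)
have : forall i, (i <= n)%N -> forall e', 0 < e' -> exists n', forall j, (n' <= j)%N ->
    normc (sqsum j k 0 (l / 2 ^+ (n - i))) <= e / 2 + e'.
  elim=> [|i IH] ilt e' e'0.
    exists 0%N => j _; rewrite subn0.
    apply: le_trans (@sqsum_bound _ j k 0 _ M (hl n) _) _; last lra.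
    move=> z [zr zi]; apply: kM; split; lra.
  have e20 : 0 < e' / 2 by lra.
  have [n1 h1] := IH (ltnW ilt) _ e20.
  set h := l / 2 ^+ (n - i.+1).
  have h0 : 0 < h by exact: hl.
  have hi : l / 2 ^+ (n - i) = h / 2.
    by rewrite /h (_ : (n - i = (n - i.+1).+1)%N); [rewrite exprSr invfM mulrA|rewrite subnSK].
  have hle : h <= l.
    by rewrite /h ler_pdivrMr ?exprn_gt0//; apply: ler_peMr; [exact: ltW|apply: exprn_ege1; lra].
  have [s [ss sE]] := sqsum_center k h0.
  have ks p : p \in s -> forall z, in_square p (h / 2 / 2) z -> cdiff k z.
    by move=> ps z /(ss _ ps)[z0 [zr zi]]; apply: kd => //; split; lra.
  have h40 : 0 < h / 2 / 2 by lra.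
  have [n2 h2] := sqsum_seq_small h40 ks e20.
  exists (n1 + n2).+2 => -[|[|j]] // jn; have {}jn : (n1 + n2 <= j)%N := jn.
  rewrite sE; apply: le_trans (le_normcD _ _) _.
  have := h1 _ (leqW (leq_trans (leq_addr n2 n1) jn)).
  have := h2 _ (leq_trans (leq_addl n1 n2) jn); rewrite hi; lra.
move=> /(_ n (leqnn n) (e / 2)) []; first lra.
rewrite subnn expr0 divr1 => n' h'; exists n' => j /h'; lra.
Qed.
End PuncturedGoursat.

(** * Vanishing of holomorphic functions of one variable *)

Section Vanishing.
Local Open Scope complex_scope.
Variable R : realType.
Local Notation K := (Cplx R).
Implicit Types (k psi : K -> K) (l e M : R).

Lemma derivable_affine (a b z : K) : derivable (fun w : K => a + b * w) z 1.
Proof.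
exact: (derivableD (@derivable_cst K K K a z 1)
  (derivableM (@derivable_cst K K K b z 1) (@derivable_id K K z 1))).
Qed.

Lemma differentiable_affine psi (a b z : K) : differentiable psi (a + b * z) ->
  differentiable (fun w => psi (a + b * w)) z.
Proof.
move=> h; have d := iffLR (@derivable1_diffP K K (fun w : K => a + b * w) z)
  (@derivable_affine a b z).
exact: (@differentiable_comp K K K K (fun w : K => a + b * w) psi z d h).
Qed.

Lemma Im_mulV (x y u v : R) :
  Im ((x +i* y)^-1 * (u +i* v)) = (x * v - y * u) / (x ^+ 2 + y ^+ 2).
Proof. by rewrite /=; ring. Qed.

Lemma edgesE (t : R) :
  [/\ (0 - (1 : R)%:C - 'i * (1 : R)%:C + t%:C * (2 * (1 : R)%:C) : K) =
        (2 * t - 1) +i* (- 1),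
      (0 + (1 : R)%:C - 'i * (1 : R)%:C + t%:C * (2 * 'i * (1 : R)%:C) : K) =
        1 +i* (2 * t - 1),
      (0 + (1 : R)%:C + 'i * (1 : R)%:C + t%:C * (- (2 * (1 : R)%:C)) : K) =
        (1 - 2 * t) +i* 1 &
      (0 - (1 : R)%:C + 'i * (1 : R)%:C + t%:C * (- (2 * 'i * (1 : R)%:C)) : K) =
        (-1) +i* (1 - 2 * t)].
Proof.
have -> : (2 : K) = (2 : R)%:C by rewrite rmorph_nat.
by split; apply/eqP; rewrite eq_complex /=; apply/andP; split; apply/eqP; ring.
Qed.

(** On each edge, [z^-1] times the direction has imaginary part [1 / |z| ^ 2], at least [1 / 2],
    over a length 2. *)
Lemma sqsum_inv_Im j : 4 <= Im (sqsum j (fun z : K => z^-1) 0 1).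
Proof.
have two : (2 : K) = (2 : R)%:C by rewrite rmorph_nat.
have key (a b v : K) : v = (2 : R)%:C * b ->
    on_segment (fun z => 1 / 2 <= Im (z^-1 * b)) a v ->
    1 <= Im (midsum j (fun z : K => z^-1) a v).
  move=> -> h.
  have := @midsum_Im_bound R j (fun z : K => z^-1) a b 2 (1 / 2) ltac:(lra) h; lra.
have half (s : R) : 0 <= s <= 1 -> 1 / 2 <= 1 / ((2 * s - 1) ^+ 2 + 1).
  by move=> /andP[s0 s1]; rewrite ler_pdivlMr; nra.
have IE (u v : K) : Im (u + v) = Im u + Im v by case: u v => ? ? [].
have k1 : 1 <= Im (midsum j (fun z : K => z^-1) (0 - (1 : R)%:C - 'i * (1 : R)%:C) (2 * (1 : R)%:C)).
  apply: (key _ (1 +i* 0)); first by rewrite two; apply/eqP; rewrite eq_complex /=; apply/andP;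
    split; apply/eqP; ring.
  move=> t /half; have [-> _ _ _] := edgesE t; rewrite Im_mulV => h.
  by rewrite [X in _ <= X](_ : _ = 1 / ((2 * t - 1) ^+ 2 + 1))//; congr (_ / _); ring.
have k2 : 1 <= Im (midsum j (fun z : K => z^-1) (0 + (1 : R)%:C - 'i * (1 : R)%:C) (2 * 'i * (1 : R)%:C)).
  apply: (key _ (0 +i* 1)); first by rewrite two; apply/eqP; rewrite eq_complex /=; apply/andP;
    split; apply/eqP; ring.
  move=> t /half; have [_ -> _ _] := edgesE t; rewrite Im_mulV => h.
  by rewrite [X in _ <= X](_ : _ = 1 / ((2 * t - 1) ^+ 2 + 1))//; congr (_ / _); ring.
have k3 : 1 <= Im (midsum j (fun z : K => z^-1) (0 + (1 : R)%:C + 'i * (1 : R)%:C) (- (2 * (1 : R)%:C))).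
  apply: (key _ ((-1) +i* 0)); first by rewrite two; apply/eqP; rewrite eq_complex /=;
    apply/andP; split; apply/eqP; ring.
  move=> t /half; have [_ _ -> _] := edgesE t; rewrite Im_mulV => h.
  by rewrite [X in _ <= X](_ : _ = 1 / ((2 * t - 1) ^+ 2 + 1))//; congr (_ / _); ring.
have k4 : 1 <= Im (midsum j (fun z : K => z^-1) (0 - (1 : R)%:C + 'i * (1 : R)%:C) (- (2 * 'i * (1 : R)%:C))).
  apply: (key _ (0 +i* (-1))); first by rewrite two; apply/eqP; rewrite eq_complex /=;
    apply/andP; split; apply/eqP; ring.
  move=> t /half; have [_ _ _ ->] := edgesE t; rewrite Im_mulV => h.
  by rewrite [X in _ <= X](_ : _ = 1 / ((2 * t - 1) ^+ 2 + 1))//; congr (_ / _); ring.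
by rewrite /sqsum !IE; lra.
Qed.

(* The product [g] of the four rotations of [psi] vanishes on the boundary of the
   square, so Cauchy's formula for [g] at the centre gives [g 0 = psi 0 ^ 4 = 0]. *)
Lemma square_vanish psi : (forall z : K, in_square 0 1 z -> differentiable psi z) ->
  (forall y : R, -1 <= y <= 1 -> psi (1 +i* y) = 0) -> psi 0 = 0.
Proof.
move=> dpsi psi0.
pose g z := psi z * psi ('i * z) * psi (- z) * psi (- ('i * z)).
have rot (z : K) : in_square 0 1 z ->
    [/\ in_square 0 1 ('i * z), in_square 0 1 (- z) & in_square 0 1 (- ('i * z))].
  case: z => x y; rewrite /in_square /= !subr0 !(mul0r, mul1r) => -[xl yl].
  by rewrite !(sub0r, add0r, normrN).
have dg (z : K) : in_square 0 1 z -> derivable g z 1.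
  move=> zi; have [z1 z2 z3] := rot z zi.
  have d0 : derivable psi z 1 by exact: (iffRL (@derivable1_diffP K K psi z) (dpsi z zi)).
  have dr (b : K) : in_square 0 1 (b * z) -> derivable (fun w => psi (b * w)) z 1.
    move=> bz; apply: (iffRL (@derivable1_diffP K K _ z)).
    have -> : (fun w => psi (b * w)) = (fun w => psi (0 + b * w)).
      by apply/funext => w; rewrite add0r.
    by apply: differentiable_affine; rewrite add0r; exact: dpsi.
  have d1 : derivable (fun w => psi ('i * w)) z 1 by exact: dr.
  have d2 : derivable (fun w => psi (- w)) z 1.
    have -> : (fun w => psi (- w)) = (fun w => psi (-1 * w)).
      by apply/funext => w; rewrite mulN1r.
    by apply: dr; rewrite mulN1r.
  have d3 : derivable (fun w => psi (- ('i * w))) z 1.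
    have -> : (fun w => psi (- ('i * w))) = (fun w => psi (- 'i * w)).
      by apply/funext => w; rewrite mulNr.
    by apply: dr; rewrite mulNr.
  exact: (derivableM (derivableM (derivableM d0 d1) d2) d3).
(* Holomorphic off the origin and bounded near it; at the origin it is 0. On the boundary, where [g]
   vanishes, it equals [- g 0 * z^-1]. *)
pose k z := (g z - g 0) * z^-1.
have dk (z : K) : in_square 0 1 z -> z != 0 -> cdiff k z.
  move=> zi z0; apply: derivable_cdiff.
  have h1 : derivable (fun w : K => g w - g 0) z 1.
    exact: (derivableB (dg z zi) (@derivable_cst K K K (g 0) z 1)).
  have h2 : derivable (fun w : K => w^-1) z 1.
    exact: (@derivableV K K id z 1 z0 (@derivable_id K K z 1)).
  exact: (derivableM h1 h2).
have [d [M [d0 kM]]] : exists d M, 0 < d /\ forall z : K, in_square 0 d z -> normc (k z) <= M.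
  have z0 : in_square 0 1 (0 : K) by rewrite /in_square subrr /= normr0.
  have [a /(_ 1 ltr01) [d d0 h]] := derivable_cdiff (dg _ z0).
  exists (d / 3), (normc a + 1); split; first lra.
  move=> z zi; have [->|zn0] := eqVneq z 0.
    by rewrite /k subrr mul0r normc0 addr_ge0 ?normc_ge0.
  have zd : normc (z - 0) < d.
    by apply: le_lt_trans (normc_le_ReIm _) _; case: zi => zr zi'; lra.
  have := h z zd; rewrite subr0 mul1r => hz.
  have zN : 0 < normc z.
    by rewrite lt_neqAle normc_ge0 andbT eq_sym; apply: contra_neq zn0; exact: eq0_normc.
  rewrite /k normcM normcV -(ler_pM2r zN) divfK ?gt_eqF//.
  have -> : g z - g 0 = (g z - g 0 - a * z) + a * z by ring.
  by apply: le_trans (le_normcD _ _) _; rewrite normcM; lra.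
have edge j : sqsum j k 0 1 = - g 0 * sqsum j (fun z : K => z^-1) 0 1.
  have gk (a v : K) : on_segment (fun z => g z = 0) a v ->
      midsum j k a v = - g 0 * midsum j (fun z : K => z^-1) a v.
    move=> h; rewrite -midsumZ; apply: eq_msum => t t01.
    by rewrite /k h// sub0r.
  have h1 : on_segment (fun z => g z = 0) (0 - (1 : R)%:C - 'i * (1 : R)%:C) (2 * (1 : R)%:C).
    move=> t /andP[t0 t1]; have [-> _ _ _] := edgesE t; rewrite /g.
    have -> : 'i * ((2 * t - 1) +i* -1) = 1 +i* (2 * t - 1) :> K 
      by apply/eqP; rewrite eq_complex /=; apply/andP; split; apply/eqP; ring.
    by rewrite psi0 ?(mul0r, mulr0)//; lra.
  have h2 : on_segment (fun z => g z = 0) (0 + (1 : R)%:C - 'i * (1 : R)%:C) (2 * 'i * (1 : R)%:C).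
    move=> t /andP[t0 t1]; have [_ -> _ _] := edgesE t; rewrite /g.
    by rewrite psi0 ?(mul0r, mulr0)//; lra.
  have h3 : on_segment (fun z => g z = 0) (0 + (1 : R)%:C + 'i * (1 : R)%:C) (- (2 * (1 : R)%:C)).
    move=> t /andP[t0 t1]; have [_ _ -> _] := edgesE t; rewrite /g.
    have -> : - ('i * ((1 - 2 * t) +i* 1)) = 1 +i* (2 * t - 1) :> K.
      by apply/eqP; rewrite eq_complex /=; apply/andP; split; apply/eqP; ring.
    by rewrite psi0 ?(mul0r, mulr0)//; lra.
  have h4 : on_segment (fun z => g z = 0) (0 - (1 : R)%:C + 'i * (1 : R)%:C) (- (2 * 'i * (1 : R)%:C)).
    move=> t /andP[t0 t1]; have [_ _ _ ->] := edgesE t; rewrite /g.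
    have -> : - ((-1) +i* (1 - 2 * t)) = 1 +i* (2 * t - 1) :> K.
      by apply/eqP; rewrite eq_complex /=; apply/andP; split; apply/eqP; ring.
    by rewrite psi0 ?(mul0r, mulr0)//; lra.
  rewrite /sqsum (gk _ _ h1) (gk _ _ h2) (gk _ _ h3) (gk _ _ h4); ring.
have g0 : normc (g 0) = 0.
  apply/eqP; rewrite eq_le normc_ge0 andbT leNgt; apply/negP => gp.
  (* With the tolerance [normc (g 0)] itself: the sum has modulus at least [4 * normc (g 0)]. *)
  have [n /(_ n (leqnn n))] := sqsum_small_punctured ltr01 d0 dk kM gp.
  rewrite edge normcM normcN leNgt => /negP; apply.
  rewrite ltr_pMr//; apply: lt_le_trans (Im_le_normc _).
  apply: lt_le_trans (ler_norm _); apply: lt_le_trans (sqsum_inv_Im n); lra.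
have := eq0_normc g0; rewrite /g mulr0 !oppr0 => /eqP.
by rewrite !mulf_eq0 !orbb => /eqP.
Qed.

(* If [|c| < 5 a / 4], the square centred
   at [c] of half-side [|c| / 2] has a side inside the disc of radius [a]. *)
Lemma disc_growth psi (a r : R) : 0 < a -> 2 * a <= r ->
  (forall z : K, normc z < r -> differentiable psi z) ->
  (forall z : K, normc z < a -> psi z = 0) ->
  forall z : K, normc z < 5 / 4 * a -> psi z = 0.
Proof.
move=> a0 ar dpsi psi0 c ca.
have two : (2 : K) = (2 : R)%:C by rewrite rmorph_nat.
(* The side [Re w = 1] is the one facing the origin. The factor [|2 - w|] is at most
   [sqrt 10 < 16 / 5] on the square and at most [sqrt 2 < 3 / 2] on that side; times
   [|c| / 2 < 5 / 8 * a], this stays below [2 * a] and below [a]. *)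
pose q w := psi (c + (- (c / 2)) * w).
have ptE (w : K) : c + (- (c / 2)) * w = c * ((2 - w) / 2) by field.
have cge := normc_ge0 c.
have normS (x y : R) : normc (x +i* y) ^+ 2 = x ^+ 2 + y ^+ 2.
  by rewrite /= sqr_sqrtr// addr_ge0 ?sqr_ge0.
have -> : psi c = q 0 by rewrite /q mulr0 addr0.
apply: square_vanish => [w wi|y /andP[y0 y1]]; rewrite /q.
  apply: differentiable_affine; apply: dpsi.
  apply: lt_le_trans ar; rewrite ptE normcM normc_half.
  have {wi} n2 : normc (2 - w) <= 16 / 5.
    rewrite -(@ler_pXn2r _ 2)// ?nnegrE ?normc_ge0//.
    case: w wi => x y wi.
    have [/andP[x1 x2] /andP[y1 y2]] : -1 <= x <= 1 /\ -1 <= y <= 1.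
      by move: wi; rewrite /in_square /= !subr0 -!ler_norml.
    rewrite (_ : normc _ = normc ((2 - x) +i* (- y))); last first.
      by congr normc; rewrite two; apply/eqP; rewrite eq_complex /=; apply/andP; split;
        apply/eqP; ring.
    have h1 : (2 - x) ^+ 2 <= 9 by nra.
    have h2 : (- y) ^+ 2 <= 1 by nra.
    rewrite normS; lra.
  have := ler_wpM2l cge n2; lra.
apply: psi0; rewrite ptE normcM normc_half.
have n2 : normc (2 - (1 +i* y)) <= 3 / 2.
  rewrite -(@ler_pXn2r _ 2)// ?nnegrE ?normc_ge0//.
  rewrite (_ : normc _ = normc (1 +i* (- y))); last first.
    by congr normc; rewrite two; apply/eqP; rewrite eq_complex /=; apply/andP; split; apply/eqP;
      ring.
  have h1 : (- y) ^+ 2 <= 1 by nra.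
  rewrite normS; lra.
have := ler_wpM2l cge n2; lra.
Qed.

(** Iterates [disc_growth]. Since each step needs twice the current radius, the radius is capped at
    [2 * r] inside a domain of radius [4 * r]. *)
Lemma disc_vanish psi (a r : R) : 0 < a ->
  (forall z : K, normc z < 4 * r -> differentiable psi z) ->
  (forall z : K, normc z < a -> psi z = 0) ->
  forall z : K, normc z < r -> psi z = 0.
Proof.
move=> a0 dpsi psi0.
have step n : (forall z : K, normc z < Num.min (2 * r) ((5 / 4) ^+ n * a) -> psi z = 0).
  elim: n => [|n IH] z; first by rewrite expr0 mul1r lt_min => /andP[_]; exact: psi0.
  rewrite lt_min => /andP[zr za].
  have r0 : 0 < r by have := normc_ge0 z; lra.
  set m := Num.min (2 * r) ((5 / 4) ^+ n * a).
  have m0 : 0 < m by rewrite lt_min !mulr_gt0// exprn_gt0//; lra.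
  have m2 : m <= 2 * r by rewrite ge_min lexx.
  have mr : 2 * m <= 4 * r by lra.
  apply: (disc_growth m0 mr dpsi IH).
  have [->|->] : m = 2 * r \/ m = (5 / 4) ^+ n * a.
  - by rewrite /m; case: leP => _; [left|right].
  - by clear -zr r0; lra.
  - by rewrite mulrA -exprS.
move=> z zr; have r0 : 0 < r by have := normc_ge0 z; lra.
(* By the Bernoulli-type bound below, [(5 / 4) ^+ n] is at least [n / 4], which exceeds [r / a]. *)
pose n := (4 * Num.truncn (r / a)).+4.
apply: (step n); rewrite lt_min; apply/andP; split; first lra.
apply: lt_trans zr _; rewrite -ltr_pdivrMr//.
apply: lt_le_trans (truncnS_gt _) _.
have bern i : (i%:R : R) / 4 <= (5 / 4) ^+ i.
  elim: i => [|i IH]; first by rewrite mul0r expr0.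
  have : 1 <= (5 / 4 : R) ^+ i by apply: exprn_ege1; lra.
  by rewrite exprS -[i.+1%:R]natr1; lra.
apply: le_trans (bern n).
have -> : (n%:R : R) = 4 * (Num.truncn (r / a))%:R + 4.
  by rewrite /n -[_.+4]addn4 natrD natrM.
rewrite -[(Num.truncn (r / a)).+1%:R]natr1; lra.
Qed.

Lemma line_vanish psi (rho : R) : 2 < rho ->
  (forall z : K, normc z < rho -> differentiable psi z) ->
  (forall y : R, -1 <= y <= 1 -> psi (1 +i* y) = 0) -> psi 0 = 0.
Proof.
move=> rho2 dpsi; apply: square_vanish => z [zr zi]; apply: dpsi.
by apply: le_lt_trans (normc_le_ReIm _) _; move: zr zi; rewrite subr0; lra.
Qed.

End Vanishing.

(** * Identity principles in several variables *)

Section Norms.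
Variable R : realType.
Local Notation K := (Cplx R).

Lemma real_complexM (x y : R) : ((x * y)%:C)%C = ((x%:C)%C : K) * (y%:C)%C.
Proof. exact: (rmorphM (real_complex R)). Qed.

Lemma real_complexD (x y : R) : ((x + y)%:C)%C = ((x%:C)%C : K) + (y%:C)%C.
Proof. exact: (rmorphD (real_complex R)). Qed.

Lemma real_complex_nat (n : nat) : ((n%:R : R)%:C)%C = n%:R :> K.
Proof. exact: (rmorph_nat (real_complex R)). Qed.
Variable V : normedModType K.
Implicit Types (x y v : V) (a : K).

(** The norm of a module over [R[i]] takes values in [R[i]]; its real part brings the estimates into
    [R]. *)
Definition nrm v : R := Re `|v|.

Lemma nrmE v : `|v| = ((nrm v)%:C)%C.
Proof. by rewrite /nrm RRe_real// normr_real. Qed.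

Lemma nrm_ge0 v : 0 <= nrm v.
Proof. by have := normr_ge0 v; rewrite nrmE lecR. Qed.

Lemma nrmD x y : nrm (x + y) <= nrm x + nrm y.
Proof. by have := ler_normD x y; rewrite !nrmE -real_complexD lecR. Qed.

Lemma nrmZ a v : nrm (a *: v) = normc a * nrm v.
Proof.
have := nrmE (a *: v); rewrite normrZ nrmE norm_normc -real_complexM => /(@complexI R) e.
by rewrite e.
Qed.

Lemma nrm0 : nrm 0 = 0.
Proof. by have := nrmE 0; rewrite normr0 => /(@complexI R) <-. Qed.

Lemma nrm_subC x y : nrm (x - y) = nrm (y - x).
Proof. by rewrite /nrm distrC. Qed.

Lemma nrm_sub x y z : nrm (x - z) <= nrm (x - y) + nrm (y - z).
Proof. by rewrite -[x - z](subrKA y); exact: nrmD. Qed.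

Lemma near_nrm x (P : V -> Prop) : (\near x, P x) ->
  exists2 d : R, 0 < d & forall y, nrm (y - x) < d -> P y.
Proof.
move=> /nbhs_normP[_ /= /pos_complexE[d d0 ->] h].
exists d => // y yd; apply: h => /=.
by rewrite /ball_ /= -normrN opprB nrmE ltcR.
Qed.

Lemma nrm_near x (P : V -> Prop) (d : R) : 0 < d ->
  (forall y, nrm (y - x) < d -> P y) -> \near x, P x.
Proof.
move=> d0 h; apply/nbhs_normP; exists ((d%:C)%C); first by rewrite /= ltcR.
by move=> y /=; rewrite /ball_ /= -normrN opprB nrmE ltcR; exact: h.
Qed.

Lemma differentiable_line (phi : V -> K) x v (w : K) :
  differentiable phi (x + w *: v) ->
  differentiable (fun u : K => phi (x + u *: v)) w.
Proof.
move=> h.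
have d : differentiable (fun u : K => x + u *: v) w.
  apply: (@differentiableD K K V (cst x) (fun u => u *: v) w).
    exact: differentiable_cst.
  by have [] := @is_diff_scalel K V w v.
exact: (@differentiable_comp K K V K (fun u : K => x + u *: v) phi w d h).
Qed.

(** Restricts [phi] to the complex line from [w0] to [z], which stays in the linear condition [E].
    The point [z] has parameter 1, inside the disc of radius [3 / 2]; [disc_vanish] asks for the
    parameter disc of radius 6, which reaches at most [13 * rho] from [p0]. *)
Lemma ball_identity (phi : V -> K) (E : V -> Prop) p0 w0 (rho a : R) :
  (forall x y c, E x -> E y -> E (x + c *: y)) ->
  (forall z, nrm (z - p0) < 16 * rho -> differentiable phi z) ->
  nrm (w0 - p0) < rho -> E w0 -> 0 < a ->
  (forall z, E z -> nrm (z - w0) < a -> phi z = 0) ->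
  forall z, E z -> nrm (z - p0) < rho -> phi z = 0.
Proof.
move=> Elin dphi w0p Ew0 a0 phi0 z Ez zp.
pose v := z - w0.
have Ev : E v by rewrite /v -scaleN1r; exact: Elin.
have vn : nrm v < 2 * rho.
  have := nrm_sub z p0 w0; rewrite -/v (nrm_subC p0); lra.
have v0 := nrm_ge0 v.
pose psi u := phi (w0 + u *: v).
have -> : phi z = psi 1 by rewrite /psi scale1r /v addrC subrK.
have step u : nrm (w0 + u *: v - w0) = normc u * nrm v.
  by rewrite addrAC subrr add0r nrmZ.
apply: (@disc_vanish R psi (a / (nrm v + 1)) (3 / 2)).
- by rewrite divr_gt0//; lra.
- move=> u u6; apply: differentiable_line; apply: dphi.
  have := nrm_sub (w0 + u *: v) w0 p0; rewrite step.
  have u0 := normc_ge0 u; nra.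
- move=> u; rewrite ltr_pdivlMr; last lra.
  move=> ua; apply: phi0; first exact: Elin.
  rewrite step; have u0 := normc_ge0 u; lra.
- by rewrite normc1; lra.
Qed.
End Norms.

(** * The Hermitian form *)

Section Hform.
Variables (R : realType) (r s t : nat).
Local Notation K := (Cplx R).
Local Notation n := (r + s + t)%N.
Implicit Types (x y z v w : 'rV[K]_n) (a b : K).

Definition sgn_coord (j : nat) : K := (j < r)%:R - (r <= j < r + s)%:R.

Lemma hformE z w :
  hform z w = \sum_(j < n) sgn_coord j * (z ord0 j * (w ord0 j)^*).
Proof.
rewrite /hform [in LHS]big_mkcond [X in _ - X]big_mkcond -sumrB; apply: eq_bigr => j _.
rewrite /sgn_coord mulrBl; congr (_ - _); first by case: ifP; rewrite ?mul1r ?mul0r.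
by case: ifP; rewrite ?mul1r ?mul0r.
Qed.

Definition hdual w : 'cV[K]_n := \col_(j < n) (sgn_coord j * (w ord0 j)^*).

Lemma hform_mul z w : hform z w = (z *m hdual w) ord0 ord0.
Proof. by rewrite hformE mxE; apply: eq_bigr => j _; rewrite mxE mulrCA. Qed.

Lemma hformDl x y z : hform (x + y) z = hform x z + hform y z.
Proof. by rewrite !hform_mul mulmxDl mxE. Qed.

Lemma hformZl a x z : hform (a *: x) z = a * hform x z.
Proof. by rewrite !hform_mul -scalemxAl mxE. Qed.

Lemma sgn_coord_conj j : (sgn_coord j)^* = sgn_coord j.
Proof. by rewrite rmorphB !rmorph_nat. Qed.

Lemma hformC z w : hform w z = (hform z w)^*.
Proof.
rewrite !hformE rmorph_sum; apply: eq_bigr => j _ /=.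
by rewrite !rmorphM /= sgn_coord_conj conjCK [(_)^* * _]mulrC.
Qed.

Lemma hformDr x y z : hform x (y + z) = hform x y + hform x z.
Proof. by rewrite hformC hformDl rmorphD /= -!hformC. Qed.

Lemma hformZr a x z : hform x (a *: z) = a^* * hform x z.
Proof. by rewrite hformC hformZl rmorphM /= -hformC. Qed.

Lemma hformNl x z : hform (- x) z = - hform x z.
Proof. by rewrite -scaleN1r hformZl mulN1r. Qed.

Lemma hformNr x z : hform x (- z) = - hform x z.
Proof. by rewrite hformC hformNl rmorphN /= -hformC. Qed.

Lemma hform_eq0C z w : hform z w = 0 -> hform w z = 0.
Proof. by move=> e; rewrite hformC e conjC0. Qed.

Lemma hform0l z : hform 0 z = 0.
Proof. by rewrite -(scale0r 0) hformZl mul0r. Qed.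

Lemma norm_coord_le x j : `|x ord0 j| <= `|x|.
Proof.
have -> : `|x| = mx_norm x by [].
rewrite mx_normE -[leLHS]nngE num_le.
exact: (le_bigmax _ _ (ord0, j)).
Qed.

Lemma sgn_coord_le1 j : `|sgn_coord j| <= 1.
Proof.
rewrite /sgn_coord; case: (ltnP j r) => jr.
  by rewrite subr0 normr1.
by case: (_ < _)%N; rewrite /= sub0r ?normrN1// oppr0 normr0 ler01.
Qed.

Lemma hform_le x y : normc (hform x y) <= n%:R * (nrm x * nrm y).
Proof.
rewrite -lecR !real_complexM real_complex_nat -!nrmE -norm_normc hformE.
apply: le_trans (ler_norm_sum _ _ _) _.
apply: (@le_trans _ _ (\sum_(j < n) `|x| * `|y|)); last by rewrite sumr_const card_ord mulr_natl.
apply: ler_sum => j _; rewrite !normrM norm_conjC -[leRHS]mul1r.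
by rewrite ler_pM ?mulr_ge0 ?sgn_coord_le1// ler_pM ?norm_coord_le.
Qed.

Definition perp (ps : seq 'rV[K]_n) z := forall p, p \in ps -> hform z p = 0.

Lemma perp_lin ps x y a : perp ps x -> perp ps y -> perp ps (x + a *: y).
Proof. by move=> hx hy p ps_p; rewrite hformDl hformZl hx// hy// mulr0 addr0. Qed.

Lemma perp_cons q ps z : perp (q :: ps) z <-> hform z q = 0 /\ perp ps z.
Proof.
split=> [h|[h1 h2] p]; first by split=> [|p pp]; apply: h; rewrite inE ?eqxx ?pp ?orbT.
by rewrite inE => /orP[/eqP ->|/h2].
Qed.

End Hform.

Lemma kernel_vector (F : fieldType) d e (A : 'M[F]_(d, e)) : (e < d)%N ->
  exists2 c : 'rV_d, c != 0 & c *m A = 0.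
Proof.
move=> ed; exists (nz_row (kermx A)); last exact/sub_kermxP/nz_row_sub.
rewrite nz_row_eq0 -mxrank_eq0 mxrank_ker -lt0n subn_gt0.
exact: leq_ltn_trans (rank_leq_col A) ed.
Qed.

(** * Null vectors, null spaces and uniqueness from the null cone *)

Section NullGeometry.
Variables (R : realType) (r s t : nat).
Local Notation K := (Cplx R).
Local Notation n := (r + s + t)%N.
Implicit Types (x y z v w : 'rV[K]_n) (a b : K).
Local Notation sgn := (@sgn_coord R r s).

Lemma hform_definite (d : K) v : (forall j : 'I_n, v ord0 j != 0 -> sgn j = d) ->
  hform v v = d * \sum_j `|v ord0 j| ^+ 2.
Proof.
move=> vd; rewrite hformE big_distrr; apply: eq_bigr => j _ /=.
have [->|vj] := eqVneq (v ord0 j) 0; first by rewrite mul0r normr0 expr0n !mulr0.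
by rewrite vd// normCK.
Qed.

Lemma sum_normr2_eq0 v : \sum_j `|v ord0 j| ^+ 2 = 0 -> v = 0.
Proof.
move=> /psumr_eq0P h; apply/rowP => j; rewrite mxE.
have /eqP := h (fun i _ => exprn_ge0 2 (normr_ge0 _)) j isT.
by rewrite expf_eq0 /= normr_eq0 => /eqP.
Qed.

(** Fewer than [m] linear conditions leave a nonzero vector in the definite space of the [m]
    coordinates chosen by [f]. Its support is recorded to make vectors of opposite sign
    orthogonal. *)
Lemma definite_vector m (f : 'I_m -> 'I_n) (d : K) (ps : seq 'rV[K]_n) :
  injective f -> (forall i, sgn (f i) = d) -> (size ps < m)%N ->
  exists2 e, perp ps e & hform e e = d /\ forall j, e ord0 j != 0 -> sgn j = d.
Proof.
move=> finj fd psm.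
pose S : 'M[K]_(m, n) := \matrix_(i, j) (j == f i)%:R.
pose D : 'M[K]_(n, size ps) := \matrix_(j, k) hdual (nth 0 ps k) j ord0.
have [c c0 cSD] := kernel_vector (S *m D) psm.
pose v := c *m S.
have vf i : v ord0 (f i) = c ord0 i.
  rewrite mxE (bigD1 i)//= mxE eqxx mulr1 big1 ?addr0// => k ki.
  by rewrite mxE (inj_eq finj) eq_sym (negPf ki) mulr0.
have vout j : v ord0 j != 0 -> sgn j = d.
  apply: contra_neqP => jd; rewrite mxE big1// => i _.
  rewrite mxE; case: eqP => [jf|_]; last by rewrite mulr0.
  by case: jd; rewrite jf fd.
pose N := \sum_j `|v ord0 j| ^+ 2.
have N0 : 0 < N.
  rewrite lt_neqAle sumr_ge0 ?andbT; last by move=> *; rewrite exprn_ge0.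
  rewrite eq_sym; apply: contra_neq c0 => /sum_normr2_eq0 v0.
  by apply/rowP => i; rewrite -vf v0 !mxE.
have vps : perp ps v.
  move=> p pps; have kp : (index p ps < size ps)%N by rewrite index_mem.
  have := congr1 (fun M : 'rV[K]_(size ps) => M ord0 (Ordinal kp)) cSD.
  rewrite mulmxA [in X in _ = X -> _]mxE => <-; rewrite hform_mul !mxE.
  by apply: eq_bigr => j _; rewrite -/v [D _ _]mxE nth_index.
exists ((sqrtC N)^-1 *: v).
  by move=> p pps; rewrite hformZl vps// mulr0.
split; last by move=> j; rewrite mxE mulf_eq0 negb_or => /andP[_]; exact: vout.
rewrite hformZl hformZr (hform_definite vout) -/N mulrA -normCK normfV.
rewrite ger0_norm ?sqrtC_ge0 ?ltW// exprVn sqrtCK mulrCA mulVf ?mulr1//.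
by rewrite gt_eqF.
Qed.

(** Sum and difference of a positive and a negative unit vector with disjoint supports. *)
Lemma hyperbolic_pair (ps : seq 'rV[K]_n) : (size ps < minn r s)%N ->
  exists x y, [/\ perp ps x, perp ps y, hform x x = 0, hform y y = 0 & hform x y = 2].
Proof.
rewrite leq_min => /andP[psr pss].
pose fp (i : 'I_r) : 'I_n := lshift t (lshift s i).
pose fn (i : 'I_s) : 'I_n := lshift t (rshift r i).
have [|i|e eps [ee eout]] := @definite_vector r fp 1 ps _ _ psr.
- by move=> i j /lshift_inj/lshift_inj.
- by rewrite /sgn_coord /= ltn_ord [(r <= i)%N]leqNgt ltn_ord subr0.
have [|i|g gps [gg gout]] := @definite_vector s fn (-1) ps _ _ pss.
- by move=> i j /lshift_inj/rshift_inj.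
- by rewrite /sgn_coord /= ltnNge leq_addr ltn_add2l ltn_ord sub0r.
have eg : hform e g = 0.
  rewrite hformE big1// => j _.
  have [->|ej] := eqVneq (e ord0 j) 0; first by rewrite mul0r mulr0.
  have [->|gj] := eqVneq (g ord0 j) 0; first by rewrite conjC0 !mulr0.
  have := eout j ej; rewrite (gout j gj) => /eqP.
  by rewrite eqNr oner_eq0.
have ge := hform_eq0C eg.
exists (e + g), (e - g); split.
- by rewrite -[g]scale1r; exact: perp_lin.
- by rewrite -scaleN1r; exact: perp_lin.
- by rewrite !(hformDl, hformDr) ee gg eg ge; ring.
- by rewrite !(hformDl, hformDr, hformNl, hformNr) ee gg eg ge; ring.
- by rewrite !(hformDl, hformDr, hformNl, hformNr) ee gg eg ge; ring.
Qed.

Definition null_mx m (L : 'M[K]_(m, n)) :=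
  forall x y, (x <= L)%MS -> (y <= L)%MS -> hform x y = 0.

(** With a larger rank, [L] would contain a nonzero vector vanishing on the [q] coordinates given by
    [f], and the form is definite on the remaining ones. *)
Lemma null_mx_rank_le m (L : 'M[K]_(m, n)) q (f : 'I_q -> 'I_n) (d : K) :
  null_mx L -> d != 0 ->
  (forall j, (forall i, f i <> j) -> sgn j = d) -> (\rank L <= q)%N.
Proof.
move=> nL d0 fd; rewrite leqNgt; apply/negP => qL.
pose Q : 'M[K]_(n, q) := \matrix_(j, i) (j == f i)%:R.
have [c c0 cLQ] := kernel_vector (row_base L *m Q) qL.
pose v := c *m row_base L.
have vL : (v <= L)%MS by rewrite -(eq_row_base L) submxMl.
have vf i : v ord0 (f i) = 0.
  have := congr1 (fun M : 'rV[K]_q => M ord0 i) cLQ.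
  rewrite mulmxA -/v [RHS]mxE => <-; rewrite [RHS]mxE (bigD1 (f i))//=.
  rewrite [Q _ _]mxE eqxx mulr1 big1 ?addr0//.
  by move=> j jf; rewrite [Q _ _]mxE (negPf jf) mulr0.
have := nL v v vL vL; rewrite (@hform_definite d) => [/eqP|j vj]; last first.
  by apply: fd => i fij; move: vj; rewrite -fij vf eqxx.
rewrite mulf_eq0 (negPf d0) /= => /eqP /sum_normr2_eq0 v0.
have := row_base_free L; rewrite -kermx_eq0 => /eqP k0.
have : (c <= kermx (row_base L))%MS by apply/sub_kermxP.
by rewrite k0 submx0 (negPf c0).
Qed.

Lemma null_mx_rank m (L : 'M[K]_(m, n)) : null_mx L -> (\rank L <= minn r s + t)%N.
Proof.
move=> nL; rewrite addn_minl leq_min; apply/andP; split.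
  pose f (i : 'I_(r + t)) : 'I_n :=
    match fintype.split i with inl a => lshift t (lshift s a) | inr b => rshift (r + s) b end.
  apply: (@null_mx_rank_le _ L _ f (-1)) => // j fj.
  have jr : (r <= j)%N.
    rewrite leqNgt; apply/negP => jr; apply: (fj (lshift t (Ordinal jr))).
    by apply: val_inj; rewrite /f -[lshift _ _]/(unsplit (inl _)) unsplitK.
  have js : (j < r + s)%N.
    rewrite ltnNge; apply/negP => js.
    have jt : (j - (r + s) < t)%N by rewrite ltn_subLR.
    apply: (fj (rshift r (Ordinal jt))).
    by apply: val_inj; rewrite /f -[rshift _ _]/(unsplit (inr _)) unsplitK /= subnKC.
  by rewrite /sgn_coord jr js ltnNge jr sub0r.
pose f (i : 'I_(s + t)) : 'I_n :=
  match fintype.split i with inl a => lshift t (rshift r a) | inr b => rshift (r + s) b end.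
apply: (@null_mx_rank_le _ L _ f 1) => // j fj.
have jr : (j < r)%N.
  rewrite ltnNge; apply/negP => jr.
  have [js|js] := ltnP j (r + s).
    have js' : (j - r < s)%N by rewrite ltn_subLR.
    apply: (fj (lshift t (Ordinal js'))).
    by apply: val_inj; rewrite /f -[lshift _ _]/(unsplit (inl _)) unsplitK /= subnKC.
  have jt : (j - (r + s) < t)%N by rewrite ltn_subLR.
  apply: (fj (rshift s (Ordinal jt))).
  by apply: val_inj; rewrite /f -[rshift _ _]/(unsplit (inr _)) unsplitK /= subnKC.
by rewrite /sgn_coord jr [(r <= j)%N]leqNgt jr subr0.
Qed.

(** Adding a multiple of [p] to [a] keeps the product with [p], and [l] is chosen so that the two
    cross terms cancel [hform a a]. *)
Lemma null_direction (ps : seq 'rV[K]_n) p (a : 'rV[K]_n) : perp ps p -> hform p p = 0 ->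
  perp ps a -> hform p a != 0 ->
  exists v, [/\ perp ps v, hform v v = 0 & hform v p != 0].
Proof.
move=> pps pp aps pa.
have ap : hform a p != 0 by apply: contra_neq pa => /hform_eq0C.
pose l := - (hform a a / (2 * hform p a)).
have X : l * hform p a = - (hform a a / 2) by rewrite /l; field.
have X' : l^* * hform a p = - (hform a a / 2).
  by rewrite (hformC p a) -rmorphM /= X rmorphN fmorph_div /= -hformC rmorph_nat.
exists (a + l *: p); split; first exact: perp_lin.
  by rewrite !(hformDl, hformDr, hformZl, hformZr) pp X X'; field.
by rewrite hformDl hformZl pp mulr0 addr0.
Qed.

Lemma small_scale (D d : R) : 0 <= D -> 0 < d ->
  exists a : R, [/\ 0 < a, a <= d & D * a <= d].
Proof.
move=> D0 d0; exists (d / (D + 1)); split; first by rewrite divr_gt0//; lra.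
  by rewrite ler_pdivrMr; nra.
by rewrite mulrA ler_pdivrMr; nra.
Qed.

(* Through a point [y] near [p] goes a complex line [y + C v], with [v] null, that
   meets the null cone in the real line [Re (w) = 1] in the coordinate
   [y + w mu v], at a distance from [y] that tends to [0] with [y - p]. *)
Lemma null_identity (phi : 'rV[K]_n -> K) (ps : seq 'rV[K]_n) p0 p (a : 'rV[K]_n) (rho eta : R) :
  (forall z, nrm (z - p0) < 16 * rho -> differentiable phi z) ->
  nrm (p - p0) < rho -> perp ps p -> hform p p = 0 ->
  perp ps a -> hform p a != 0 -> 0 < eta ->
  (forall z, perp ps z -> hform z z = 0 -> nrm (z - p) < eta -> phi z = 0) ->
  forall z, perp ps z -> nrm (z - p0) < rho -> phi z = 0.
Proof.
move=> dphi pp0 pps pp aps pa eta0 phi0.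
have rho0 : 0 < rho by apply: le_lt_trans pp0; exact: nrm_ge0.
have [v [vps vv vp]] := null_direction pps pp aps pa.
have c0 : 0 < normc (hform v p).
  by rewrite lt_neqAle normc_ge0 andbT eq_sym; apply: contra_neq vp; exact: eq0_normc.
set c := normc (hform v p) in c0.
(* Bound on the displacement per unit of [w]: four units must stay where [phi] is differentiable,
   two units within [eta] of [p]. *)
pose tau := Num.min eta rho / 16.
have tau0 : 0 < tau by rewrite divr_gt0// lt_min eta0.
have tau_eta : 16 * tau <= eta.
  by rewrite /tau mulrC divfK ?pnatr_eq0// ge_min lexx.
have tau_rho : 16 * tau <= rho.
  by rewrite /tau mulrC divfK ?pnatr_eq0// ge_min lexx orbT.
have P0 := nrm_ge0 p; have V0 := nrm_ge0 v.
pose C : R := n%:R; have C0 : 0 <= C by rewrite ler0n.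
have CV0 : 0 <= C * nrm v by rewrite mulr_ge0.
have CP0 : 0 <= C * (2 * nrm p + 1) * nrm v by rewrite !mulr_ge0//; lra.
(* The four bounds serve, in order, to absorb the quadratic term of [hform y y], to keep [hform v y]
   away from 0, to keep [y] close to [p], and to bound [mu *: v] by [tau]. *)
pose d := Num.min (Num.min 1 (c / 2)) (Num.min tau (tau * c)).
have c20 : 0 < c / 2 by lra.
have tc0 : 0 < tau * c by rewrite mulr_gt0.
have d0 : 0 < d by rewrite !lt_min ltr01 c20 tau0 tc0.
have [d1 d2 d3 d4] : [/\ d <= 1, d <= c / 2, d <= tau & d <= tau * c].
  by split; rewrite !ge_min lexx ?orbT.
have [al [al0 ald Dal]] := small_scale (addr_ge0 CV0 CP0) d0.
have near y : perp ps y -> nrm (y - p) < al -> phi y = 0.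
  move=> yps yp; pose e := y - p.
  have e0 := nrm_ge0 e.
  have yE : y = p + e by rewrite /e addrC subrK.
  have hve : normc (hform v e) <= c / 2.
    apply: le_trans (hform_le _ _) _; rewrite -/C.
    have : C * nrm v * nrm e <= C * nrm v * al by rewrite ler_wpM2l// ltW.
    have : 0 <= C * (2 * nrm p + 1) * nrm v * al by rewrite mulr_ge0// ltW.
    lra.
  have hvy : c / 2 <= normc (hform v y).
    have : c <= normc (hform v y) + normc (hform v e).
      rewrite -[normc (hform v e)]normcN; apply: le_trans (le_normcD _ _).
      by rewrite yE hformDr addrK.
    lra.
  have hvy0 : hform v y != 0.
    by apply: contraTneq hvy => ->; rewrite normc0 -ltNge; lra.
  have hyy : normc (hform y y) <= C * (2 * nrm p + 1) * al.
    have key u : hform (p + u) (p + u) = hform p u + (hform u p + hform u u).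
      by rewrite !(hformDl, hformDr) pp; ring.
    rewrite yE key.
    apply: le_trans (le_normcD _ _) _.
    have h1 := hform_le p e; have h2 := hform_le e p; have h3 := hform_le e e.
    have h4 := le_normcD (hform e p) (hform e e).
    rewrite -/C in h1 h2 h3.
    have h5 : C * (nrm p * nrm e) <= C * (nrm p * al) by rewrite !ler_wpM2l// ltW.
    have h6 : C * (nrm e * nrm e) <= C * al.
      by rewrite ler_wpM2l//; move: yp; rewrite -/e; nra.
    lra.
  (* Makes the form at [y + w *: (mu *: v)] equal to [hform y y * (1 - Re w)]. *)
  pose mu := - (hform y y / (2 * hform v y)).
  have X : mu * hform v y = - (hform y y / 2) by rewrite /mu; field.
  have X' : mu^* * hform y v = - (hform y y / 2).
    by rewrite (hformC v y) -rmorphM /= X rmorphN fmorph_div /= -hformC rmorph_nat.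
  have muv : normc mu * nrm v <= tau.
    have m1 : normc mu * normc (hform v y) <= C * (2 * nrm p + 1) * al / 2.
      by rewrite -normcM X normcN normc_half; lra.
    have m0 := normc_ge0 mu.
    have m2 : normc mu * c <= C * (2 * nrm p + 1) * al.
      by have := ler_wpM2l m0 hvy; lra.
    have m3 : normc mu * c * nrm v <= C * (2 * nrm p + 1) * al * nrm v by rewrite ler_wpM2r.
    have m4 : 0 <= C * nrm v * al by rewrite mulr_ge0// ltW.
    rewrite -(ler_pM2r c0); lra.
  have pt (w : K) : nrm (y + w *: (mu *: v) - y) <= normc w * tau.
    by rewrite addrAC subrr add0r !nrmZ ler_wpM2l ?normc_ge0.
  have -> : phi y = phi (y + 0 *: (mu *: v)) by rewrite scale0r addr0.
  apply: (@line_vanish R (fun w : K => phi (y + w *: (mu *: v))) 4) => [|w w4|b /andP[b0 b1]];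
    first lra.
    apply: differentiable_line; apply: dphi.
    have := nrm_sub (y + w *: (mu *: v)) y p0; have := nrm_sub y p p0.
    have := pt w; have : normc w * tau <= 4 * tau by rewrite ler_wpM2r// ltW.
    lra.
  set w : K := (1 +i* b)%C.
  have w2 : w + w^* = 2.
    by apply/eqP; rewrite eq_complex /=; apply/andP; split; apply/eqP; ring.
  have wn : normc w <= 2.
    apply: le_trans (normc_le_ReIm _) _; rewrite /w /= normr1.
    have : `|b| <= 1 by rewrite ler_norml b0.
    lra.
  apply: phi0.
  - by apply: perp_lin => // q qps; rewrite hformZl vps// mulr0.
  - rewrite !(hformDl, hformDr, hformZl, hformZr) vv !mulr0 addr0.
    rewrite [w^* * _]mulrA -mulrA X' X -{1}(mul1r (hform y y)).
    have -> : w^* = 2 - w by rewrite -w2; ring.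
    by field.
  - have := nrm_sub (y + w *: (mu *: v)) y p; have := pt w.
    have : normc w * tau <= 2 * tau by rewrite ler_wpM2r// ltW.
    lra.
move=> z zps zp0.
exact: (@ball_identity R _ phi (perp ps) p0 p rho al (@perp_lin _ _ _ _ ps)).
Qed.

End NullGeometry.

(** * Orthogonal maps near a null point *)

Section Functional.
Variable R : realType.
Local Notation K := (Cplx R).

Lemma differentiable_functional (V : normedModType K) m (G : V -> 'rV[K]_m) (c : 'cV[K]_m) (z : V) :
  differentiable G z -> differentiable (fun z => (G z *m c) ord0 ord0) z.
Proof.
move=> dG.
have -> : (fun z => (G z *m c) ord0 ord0) = \sum_(j < m) (fun z => c j ord0 *: (G z ord0 j : K)).
  apply/funext => u; rewrite fct_sumE mxE; apply: eq_bigr => j _.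
  by rewrite mulrC.
apply: differentiable_sum => j; apply: differentiableZ.
have dc := @differentiable_coord K 1 m (G z) ord0 j.
exact: (@differentiable_comp K V _ K G (fun N : 'rV[K]_m => N ord0 j) z dG dc).
Qed.

Lemma near_neq0 (V : normedModType K) (phi : V -> K) (z : V) : differentiable phi z ->
  phi z != 0 -> exists2 d : R, 0 < d & forall y, nrm (y - z) < d -> phi y != 0.
Proof.
move=> dphi phiz; apply: near_nrm.
have := @differentiable_continuous K V K z phi dphi.
move=> /cvgrPdist_lt /(_ `|phi z|); rewrite normr_gt0 => /(_ phiz) h.
apply: filterS h => y /=; apply: contraTneq => ->.
by rewrite subr0 ltxx.
Qed.

Lemma nrm_shift_lt (V : normedModType K) (x v p : V) (d : R) :
  nrm v < d - nrm (x - p) -> nrm (x + v - p) < d.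
Proof. by rewrite ltrBrDl addrAC; apply: le_lt_trans; exact: nrmD. Qed.

Lemma small_multiple (V : normedModType K) (x : V) (d : R) : 0 < d ->
  exists e : K, [/\ e != 0, e^* = e & nrm (e *: x) < d].
Proof.
move=> d0; have x0 := nrm_ge0 x.
pose e : R := d / (2 * (nrm x + 1)).
have e0 : 0 < e by rewrite divr_gt0//; lra.
exists ((e%:C)%C); split; first by rewrite (inj_eq (@complexI R)) gt_eqF.
  exact: conjc_real.
by rewrite nrmZ normc_real gtr0_norm// /e mulrAC ltr_pdivrMr; nra.
Qed.

End Functional.

Section LocalNull.
Variables (R : realType) (r s t r' s' t' : nat).
Local Notation K := (Cplx R).
Local Notation n := (r + s + t)%N.
Local Notation n' := (r' + s' + t')%N.
Implicit Types (z w p q x y : 'rV[K]_n) (ps : seq 'rV[K]_n).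

Lemma differentiable_hforml (G : 'rV[K]_n -> 'rV[K]_n') (u : 'rV[K]_n') z :
  differentiable G z -> differentiable (fun z => hform (G z) u) z.
Proof.
have -> : (fun z => hform (G z) u) = (fun z => (G z *m hdual u) ord0 ord0).
  by apply/funext => v; exact: hform_mul.
exact: differentiable_functional.
Qed.

(** If [p] is orthogonal to the whole orthogonal of [ps], a small multiple of one vector of a
    hyperbolic pair is added: the sum is still null, and it pairs with the other vector. *)
Lemma nonradical_null_vector ps p (eta : R) : (size ps < minn r s)%N ->
  perp ps p -> hform p p = 0 -> 0 < eta ->
  exists p1 a, [/\ perp ps p1, hform p1 p1 = 0, nrm (p1 - p) < eta, perp ps a &
    hform p1 a != 0].
Proof.
move=> psm pps pp eta0.
have [[a [aps pa]]|rad] := pselect (exists a, perp ps a /\ hform p a != 0).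
  by exists p, a; split => //; rewrite subrr nrm0.
have {}rad a : perp ps a -> hform p a = 0.
  by move=> aps; apply: contrapT => /eqP pa; apply: rad; exists a.
have [x [y [xps yps xx yy xy]]] := hyperbolic_pair psm.
have [e [e0 eJ ex]] := small_multiple x eta0.
exists (p + e *: x), y; split => //.
- exact: perp_lin.
- by rewrite !(hformDl, hformDr, hformZl, hformZr) pp xx rad// (hform_eq0C (rad _ xps)); ring.
- by rewrite addrAC subrr add0r.
- by rewrite hformDl hformZl rad// xy add0r mulf_neq0// pnatr_eq0.
Qed.

(** One linear equation for [c]: near [w0] the numerator [hform w q] is small and the denominator
    [hform w z] stays away from 0. *)
Lemma tilt_perp (w0 q z : 'rV[K]_n) (d : R) : 0 < d ->
  hform w0 q = 0 -> hform w0 z != 0 -> exists2 a : R, 0 < a &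
    forall w, nrm (w - w0) < a ->
      exists2 c : K, hform w (q + c *: z) = 0 & nrm (c *: z) < d.
Proof.
move=> d0 w0q w0z.
have [c cE] : exists c : R, c = normc (hform w0 z) by eexists.
have c0 : 0 < c.
  by rewrite cE lt_neqAle normc_ge0 andbT eq_sym; apply: contra_neq w0z; exact: eq0_normc.
pose C : R := n%:R; have C0 : 0 <= C by rewrite ler0n.
have z0 := nrm_ge0 z; have q0 := nrm_ge0 q.
have D1 : 0 <= C * nrm z by rewrite mulr_ge0.
have D2 : 0 <= C * nrm q * nrm z by rewrite !mulr_ge0.
have c20 : 0 < c / 2 by lra.
have ck0 : 0 < c / 2 * (d / 2) by rewrite mulr_gt0//; lra.
pose m := Num.min (c / 2) (c / 2 * (d / 2)).
have m0 : 0 < m by rewrite lt_min c20 ck0.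
have [m1 m2] : m <= c / 2 /\ m <= c / 2 * (d / 2).
  by split; rewrite ge_min lexx ?orbT.
have [al [al0 _ Dal]] := small_scale (addr_ge0 D1 D2) m0.
exists al => // w ww0.
have wE : w = w0 + (w - w0) by rewrite addrC subrK.
have bound x : 0 <= nrm x -> normc (hform (w - w0) x) <= C * nrm x * al.
  move=> x0; apply: le_trans (hform_le _ _) _; rewrite -/C -mulrA.
  by apply: ler_wpM2l => //; rewrite mulrC; apply: ler_wpM2l => //; exact: ltW.
have hwq : normc (hform w q) <= C * nrm q * al.
  by rewrite wE hformDl w0q add0r; exact: bound.
have hwz : c / 2 <= normc (hform w z).
  have h1 := bound z z0.
  have h2 : c <= normc (hform w z) + normc (hform (w - w0) z).
    rewrite cE -[normc (hform (w - w0) z)]normcN; apply: le_trans (le_normcD _ _).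
    by rewrite -hformNl -hformDl opprB addrC subrK.
  have h3 : 0 <= C * nrm q * nrm z * al by rewrite mulr_ge0// ltW.
  by clear -h1 h2 h3 Dal m1; lra.
have hwz0 : hform w z != 0.
  by apply: contraTneq hwz => ->; rewrite normc0 -ltNge.
exists ((- (hform w q / hform w z))^*).
  by rewrite hformDr hformZr conjCK; field.
rewrite nrmZ; set a := (X in normc X).
have -> : normc a = normc (hform w q) / normc (hform w z).
  apply: (@complexI R); rewrite -[LHS](norm_normc a) norm_conjC normrN normf_div.
  by rewrite !norm_normc fmorph_div.
have hp : 0 < normc (hform w z) by exact: lt_le_trans hwz.
rewrite mulrAC ltr_pdivrMr//.
have h1 : normc (hform w q) * nrm z <= C * nrm q * al * nrm z by rewrite ler_wpM2r.
have h2 : d * (c / 2) <= d * normc (hform w z) by rewrite ler_wpM2l// ltW.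
have h3 : 0 <= C * nrm z * al by rewrite mulr_ge0// ltW.
have h4 : 0 < c / 2 * d by rewrite mulr_gt0.
by clear -h1 h2 h3 h4 Dal m2; lra.
Qed.

(* The images of null vectors [z] off the span [L] are shown orthogonal to
   everything: a null vector [q] slightly off [z] and orthogonal to it can be
   tilted to [q + alpha z] so as to be orthogonal to any [w] near [w0]. *)
Lemma null_vector_image_orthogonal (G : 'rV[K]_n -> 'rV[K]_n') p0 (rho : R)
    ps (N : 'rV[K]_n -> Prop) p1 (eta : R) z a :
  (forall z, nrm (z - p0) < 16 * rho -> differentiable G z) ->
  (size ps + 1 < minn r s)%N ->
  (forall q, nrm (q - p1) < eta -> nrm (q - p0) < rho /\ N q) ->
  (forall q, N q -> nrm (q - p0) < rho -> perp ps q -> hform q q = 0 ->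
     forall x y, nrm (x - p0) < rho -> nrm (y - p0) < rho ->
     perp (q :: ps) x -> perp (q :: ps) y -> hform (G x) (G y) = 0) ->
  nrm (z - p1) < eta -> perp ps z -> hform z z = 0 ->
  perp ps a -> hform z a != 0 ->
  forall w, perp ps w -> nrm (w - p0) < rho -> hform (G w) (G z) = 0.
Proof.
move=> Gdiff psm near IH zp1 zps zz aps za.
have [zp0 _] := near z zp1.
have rho0 : 0 < rho by apply: le_lt_trans zp0; exact: nrm_ge0.
have [|x [y [/perp_cons[xz xps] /perp_cons[yz yps] xx yy xy]]] := @hyperbolic_pair R r s t (z :: ps).
  by rewrite /= -addn1.
have zx := hform_eq0C xz; have zy := hform_eq0C yz.
have yx : hform y x = 2 by rewrite hformC xy rmorph_nat.
have az : hform a z != 0 by apply: contra_neq za => /hform_eq0C.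
have [|e [e0 eJ ez]] := @small_multiple R _ x (eta - nrm (z - p1)); first by rewrite subr_gt0.
pose q := z + e *: x.
have qps : perp ps q by exact: perp_lin.
have qq : hform q q = 0.
  by rewrite !(hformDl, hformDr, hformZl, hformZr) zz xx zx xz; ring.
have qz : hform q z = 0 by rewrite hformDl hformZl zz xz; ring.
have zq := hform_eq0C qz.
have qp1 : nrm (q - p1) < eta by exact: nrm_shift_lt.
have [qp0 _] := near q qp1.
(* Solves [hform b q = 0]; as [y] is orthogonal to [z], the product of [b] with [z] remains that of
   [a]. *)
pose tau := - ((hform a z + e * hform a x) / (2 * e)).
pose b := a + tau *: y.
have bps : perp ps b by exact: perp_lin.
have bq : hform b q = 0.
  rewrite /b /q !(hformDl, hformDr, hformZl, hformZr) eJ yz yx /tau.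
  by field.
have bz : hform b z != 0 by rewrite hformDl hformZl yz mulr0 addr0.
have [|de [de0 _ dez]] := @small_multiple R _ b (rho - nrm (q - p0)); first by rewrite subr_gt0.
pose w0 := q + de *: b.
have w0ps : perp ps w0 by exact: perp_lin.
have w0q : hform w0 q = 0 by rewrite hformDl hformZl qq bq; ring.
have w0z : hform w0 z != 0 by rewrite hformDl hformZl qz add0r mulf_neq0.
have w0p0 : nrm (w0 - p0) < rho by exact: nrm_shift_lt.
clearbody w0; clearbody b; clearbody q.
have [|al al0 tilt] := @tilt_perp w0 q z (eta - nrm (q - p1)) _ w0q w0z; first by rewrite subr_gt0.
have al'0 : 0 < Num.min al (rho - nrm (w0 - p0)) by rewrite lt_min al0 subr_gt0.
apply: (@ball_identity R _ (fun w => hform (G w) (G z)) (perp ps) p0 w0 rho _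
  (@perp_lin _ _ _ _ ps) _ w0p0 w0ps al'0).
  by move=> u /Gdiff; exact: differentiable_hforml.
move=> w wps; rewrite lt_min => /andP[/tilt[c wc cz] ww0].
have wp0 : nrm (w - p0) < rho.
  have -> : w - p0 = w0 + (w - w0) - p0 by rewrite [w0 + _]addrC subrK.
  exact: nrm_shift_lt.
have [q'p0 Nq'] := near _ (nrm_shift_lt cz).
(* The tilted point is null and orthogonal both to [w] and to [z]. *)
apply: (IH _ Nq' q'p0) => //; first exact: perp_lin.
- by rewrite !(hformDl, hformDr, hformZl, hformZr) qq qz zq zz; ring.
- by apply/perp_cons.
- by apply/perp_cons; split => //; rewrite hformDr hformZr zq zz; ring.
Qed.

Lemma null_mx_adds (L : 'M[K]_n') (u : 'rV[K]_n') : null_mx L ->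
  (forall l : 'rV_n', (l <= L)%MS -> hform u l = 0) -> hform u u = 0 -> null_mx (L + u)%MS.
Proof.
move=> nL uL uu x y /sub_addsmxP[[x1 x2] ->] /sub_addsmxP[[y1 y2] ->] /=.
have sc (a : 'M[K]_1) : a *m u = a ord0 ord0 *: u.
  by rewrite [a in LHS]mx11_scalar mul_scalar_mx.
have xL : (x1 *m L <= L)%MS by exact: submxMl.
have yL : (y1 *m L <= L)%MS by exact: submxMl.
rewrite !sc !(hformDl, hformDr, hformZl, hformZr) uu uL//.
rewrite (hform_eq0C (uL _ xL)) nL//; ring.
Qed.

(* Descending induction on [ps]: [L] is a null space orthogonal to the images of
   the points orthogonal to [ps]; its rank beyond [t'] is at least [size ps] and
   at most [min(r', s')]. *)
Lemma local_null (G : 'rV[K]_n -> 'rV[K]_n') p0 (rho : R) :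
  (forall z, nrm (z - p0) < 16 * rho -> differentiable G z) ->
  (forall z w, nrm (z - p0) < rho -> nrm (w - p0) < rho ->
     hform z w = 0 -> hform (G z) (G w) = 0) ->
  (minn r' s' < minn r s)%N ->
  forall d ps (L : 'M[K]_n') p, (minn r' s' < size ps + d)%N ->
  (size ps + t' <= \rank L)%N -> null_mx L ->
  (forall z (l : 'rV_n'), perp ps z -> nrm (z - p0) < rho -> (l <= L)%MS ->
     hform (G z) l = 0) ->
  perp ps p -> nrm (p - p0) < rho -> hform p p = 0 ->
  forall z w, nrm (z - p0) < rho -> nrm (w - p0) < rho ->
    perp ps z -> perp ps w -> hform (G z) (G w) = 0.
Proof.
move=> Gd Go mm; elim=> [|d IH] ps L p psd psL nL GL pps pp0 pp z w zp0 wp0 zps wps.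
  have := leq_trans psL (null_mx_rank nL); rewrite leq_add2r leqNgt.
  by move: psd; rewrite addn0 => ->.
have psm : (size ps <= minn r' s')%N.
  by have := leq_trans psL (null_mx_rank nL); rewrite leq_add2r.
have psm' := leq_ltn_trans psm mm.
(* Membership of [G u] in [L] becomes the vanishing of finitely many holomorphic functions. *)
have coordE (u : 'rV[K]_n) j : (G u *m cokermx L) ord0 j = (G u *m col j (cokermx L)) ord0 ord0.
  by rewrite [LHS]mxE [RHS]mxE; apply: eq_bigr => k _; rewrite [in RHS]mxE.
have cd j u : nrm (u - p0) < 16 * rho ->
    differentiable (fun u => (G u *m col j (cokermx L)) ord0 ord0) u.
  by move=> up; apply: differentiable_functional; exact: Gd.
have rho0 : 0 < rho by apply: le_lt_trans pp0; exact: nrm_ge0.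
have [[p1 [p1ps p1p0 p11 p1L]]|allL] := pselect (exists p1, [/\ perp ps p1,
    nrm (p1 - p0) < rho, hform p1 p1 = 0 & ~~ (G p1 <= L)%MS]); last first.
  have eta0 : 0 < rho - nrm (p - p0) by rewrite subr_gt0.
  have [p2 [a [p2ps p22 p2p aps p2a]]] := nonradical_null_vector psm' pps pp eta0.
  have p2p0 : nrm (p2 - p0) < rho.
    by apply: le_lt_trans (nrm_sub p2 p p0) _; rewrite -ltrBrDr.
  have eta20 : 0 < rho - nrm (p2 - p0) by rewrite subr_gt0.
  have allG u : perp ps u -> nrm (u - p0) < rho -> (G u <= L)%MS.
    move=> ups up0; rewrite submxE; apply/eqP/rowP => j; rewrite [RHS]mxE coordE.
    move: u ups up0; apply: (null_identity (cd j) p2p0 p2ps p22 aps p2a eta20).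
    move=> u ups uu up2.
    have up0 : nrm (u - p0) < rho.
      by apply: le_lt_trans (nrm_sub u p2 p0) _; rewrite -ltrBrDr.
    have : (G u <= L)%MS.
      by apply: contrapT => /negP uL; apply: allL; exists u.
    by rewrite submxE -coordE => /eqP ->; rewrite mxE.
  by apply: nL; exact: allG.
have adds q : ~~ (G q <= L)%MS -> nrm (q - p0) < rho -> perp ps q -> hform q q = 0 ->
    null_mx (L + G q)%MS /\ (size (q :: ps) + t' <= \rank (L + G q)%MS)%N.
  move=> qL qp0 qps qq; split.
    apply: null_mx_adds => // [l lL|]; first exact: GL.
    exact: Go.
  apply: leq_ltn_trans psL (rank_ltmx _); rewrite ltmxE addsmxSl /=.
  by apply: contra qL; exact: submx_trans (addsmxSr _ _).
(* The enlarged null space obeys the rank bound too, which leaves room for a hyperbolic pair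
   orthogonal to one more point. *)
have psm1 : (size ps + 1 < minn r s)%N.
  have [n1 r1] := adds p1 p1L p1p0 p1ps p11.
  have := leq_trans r1 (null_mx_rank n1); rewrite leq_add2r /= -addn1 => h.
  exact: leq_ltn_trans h mm.
have step q : ~~ (G q <= L)%MS -> nrm (q - p0) < rho -> perp ps q -> hform q q = 0 ->
     forall x y, nrm (x - p0) < rho -> nrm (y - p0) < rho ->
     perp (q :: ps) x -> perp (q :: ps) y -> hform (G x) (G y) = 0.
  move=> qL qp0 qps qq x y xp yp xps yps.
  have [nL' rL'] := adds q qL qp0 qps qq.
  apply: (IH (q :: ps) _ q _ rL' nL') => //; first by rewrite /= addSnnS.
    move=> u l /perp_cons[uq ups] up0 /sub_addsmxP[[l1 l2] ->] /=.
    rewrite [l2]mx11_scalar mul_scalar_mx hformDr hformZr.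
    by rewrite GL// ?submxMl// Go// mulr0 addr0.
  by apply/perp_cons.
have [eta eta0 near] : exists2 eta : R, 0 < eta & forall q, nrm (q - p1) < eta ->
    nrm (q - p0) < rho /\ ~~ (G q <= L)%MS.
  have [j p1j] : exists j, (G p1 *m cokermx L) ord0 j != 0.
    apply: contrapT => h; move/negP: p1L; apply; rewrite submxE; apply/eqP/rowP => j.
    by rewrite [RHS]mxE; apply: contrapT => /eqP hj; apply: h; exists j.
  have d1 : differentiable (fun u => (G u *m col j (cokermx L)) ord0 ord0) p1.
    by apply: cd; lra.
  have [|e e0 eP] := near_neq0 d1; first by rewrite -coordE.
  exists (Num.min e (rho - nrm (p1 - p0))); first by rewrite lt_min e0 subr_gt0.
  move=> q; rewrite lt_min => /andP[/eP qe qr]; split.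
    by apply: le_lt_trans (nrm_sub q p1 p0) _; rewrite -ltrBrDr.
  by apply: contra qe; rewrite -coordE submxE => /eqP ->; rewrite mxE.
have eta20 : 0 < eta / 2 by lra.
have [p2 [a [p2ps p22 p2p1 aps p2a]]] := nonradical_null_vector psm' p1ps p11 eta20.
have p2p0 : nrm (p2 - p0) < rho by apply: (near p2 _).1; lra.
pose phi u := hform (G u) (G w).
have dphi u : nrm (u - p0) < 16 * rho -> differentiable phi u.
  by move=> /Gd; exact: differentiable_hforml.
apply: (null_identity dphi p2p0 p2ps p22 aps p2a eta20) => // u ups uu up2.
have up1 : nrm (u - p1) < eta by apply: le_lt_trans (nrm_sub u p2 p1) _; rewrite [eta]splitr ltrD.
have up0 := (near u up1).1.
have [[b [bps ub]]|rad] := pselect (exists b, perp ps b /\ hform u b != 0).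
  apply: hform_eq0C.
  exact: (null_vector_image_orthogonal Gd psm1 near step up1 ups uu bps ub).
(* A radical [u] is itself orthogonal to [w]. *)
apply: Go => //; apply: contrapT => /eqP uw; apply: rad; exists w; split => //.
Qed.

End LocalNull.

(** * From a neighbourhood of the null point to the whole domain *)

Section GlobalStep.
Variables (R : realType).
Local Notation K := (Cplx R).

(** [Z] is a zero set only locally, because the holomorphic lifts of a projective map are local. Its
    interior is open, and relatively closed in [U] by [ball_identity]. *)
Lemma connected_identity (V : normedModType K) (U Z : set V) :
  connected U ->
  (forall z, U z -> exists rho (phi : V -> K), 0 < rho /\
     forall w, nrm (w - z) < 16 * rho ->
       [/\ U w, differentiable phi w & phi w = 0 <-> Z w]) ->
  (exists z a, [/\ U z, 0 < a & forall w, nrm (w - z) < a -> Z w]) ->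
  forall z, U z -> Z z.
Proof.
move=> Uc loc [z0 [a0 [Uz0 a00 Zz0]]].
pose inner z := exists2 a : R, 0 < a & forall w, nrm (w - z) < a -> Z w.
suff UE : U `&` inner = U.
  move=> z; rewrite -UE => -[_ [a a0' h]]; apply: h.
  by rewrite subrr nrm0.
apply: Uc.
- by exists z0; split => //; exists a0.
- exists inner => //; rewrite openE => z [a a0' h].
  apply: (@nrm_near R V z inner (a / 2)); first lra.
  move=> w wz; exists (a / 2); first lra.
  by move=> v vw; apply: h; have := nrm_sub v w z; lra.
exists (closure (U `&` inner)); first exact: closed_closure.
apply/seteqP; split=> [z [Uz iz]|z [Uz cz]].
  by split => //; apply: subset_closure.
split=> //; have [rho [phi [rho0 h]]] := loc z Uz.
have [|z1 [[Uz1 [a a0' h1]] /= z1z]] := cz [set w | nrm (w - z) < rho].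
  by apply: (@nrm_near R V z _ rho).
exists rho => // w wz.
have E0 : nrm (w - z) < 16 * rho by lra.
have [_ _ pZ] := h w E0; apply/pZ.
have m0 : 0 < Num.min a rho by rewrite lt_min a0'.
apply: (@ball_identity R V phi (fun=> True) z z1 rho _ _ _ z1z _ m0) => // u.
  by move=> /h[].
move=> _; rewrite lt_min => /andP[ua ur].
have uz : nrm (u - z) < 16 * rho by have := nrm_sub u z1 z; lra.
by have [_ _ e] := h u uz; apply/e; exact: h1.
Qed.

(** A finite family in [A] whose span has maximal dimension; nullity of the span of an image can
    then be checked on image points. *)
Lemma span_family (vT : vectType K) (A : set vT) : exists X : seq vT,
  (forall u, u \in X -> A u) /\ forall u, A u -> u \in <<X>>%VS.
Proof.
pose P d := `[< exists2 X : seq vT, (forall u, u \in X -> A u) & \dim <<X>>%VS = d >].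
have exP : exists d, P d.
  by exists 0%N; apply/asboolP; exists [::] => //; rewrite span_nil dimv0.
have bP d : P d -> (d <= \dim {:vT})%N.
  by move=> /asboolP[X _ <-]; exact/dimvS/subvf.
case: (ex_maxnP exP bP) => d /asboolP[X XA dX] dmax.
exists X; split=> // u Au.
have sub : (<<X>> <= <<u :: X>>)%VS by apply: sub_span => v vX; rewrite inE vX orbT.
have : (<<X>> == <<u :: X>>)%VS.
  rewrite eqEdim sub dX; apply: dmax; apply/asboolP; exists (u :: X) => // v.
  by rewrite inE => /orP[/eqP ->|/XA].
by move=> /eqP ->; apply: memv_span; rewrite inE eqxx.
Qed.

Lemma null_span r s t (X : seq 'rV[K]_(r + s + t)) :
  (forall u v, u \in X -> v \in X -> hform u v = 0) ->
  forall x y, x \in <<X>>%VS -> y \in <<X>>%VS -> hform x y = 0.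
Proof.
move=> nX.
have left (v x : 'rV[K]_(r + s + t)) : (forall u, u \in X -> hform u v = 0) ->
    x \in <<X>>%VS -> hform x v = 0.
  move=> uv xX; rewrite (coord_span (X := in_tuple X) xX).
  elim/big_ind : _ => [|a b ha hb|i _]; first by rewrite hform0l.
    by rewrite hformDl ha hb addr0.
  by rewrite hformZl uv ?mulr0// mem_nth.
move=> x y xX yX; apply: (left y x _ xX) => u uX; apply: hform_eq0C.
by apply: (left u y _ yX) => v vX; exact: nX.
Qed.

End GlobalStep.

(** * The radical of the form *)

Section RadicalNull.
Variables (R : realType) (r s t : nat).
Local Notation K := (Cplx R).

Definition radical_mx : 'M[K]_(r + s + t) :=
  genmx (row_mx (0 : 'M[K]_(t, r + s)) (1%:M : 'M[K]_t)).

Lemma radical_mx_rank : \rank radical_mx = t.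
Proof. by rewrite genmxE rank_row_0mx mxrank1. Qed.

Lemma hform_radical (x l : 'rV[K]_(r + s + t)) : (l <= radical_mx)%MS -> hform x l = 0.
Proof.
rewrite genmxE => /submxP[u ->]; rewrite mul_mx_row mulmx0 mulmx1.
rewrite hformE big1// => j _; case: (fintype.splitP j) => k jk.
  have -> : j = lshift t k by apply: val_inj.
  by rewrite row_mxEl mxE conjC0 !mulr0.
rewrite /sgn_coord jk [(_ < r)%N]ltnNge -addnA leq_addr [(_ < r + s)%N]ltnNge addnA leq_addr.
by rewrite andbF subrr mul0r.
Qed.
End RadicalNull.

Theorem mainTheorem8 (R : realType) (r s t r' s' t' : nat)
  (Ut : set 'rV[Cplx R]_(r + s + t))
  (f : 'rV[Cplx R]_(r + s + t) -> 'rV[Cplx R]_(r' + s' + t')) :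
  (0 < r + s + t)%N ->
  (minn r' s' < minn r s)%N ->
  proj_cone Ut -> open Ut -> connected Ut ->
  (exists z, Ut z /\ null_vec z) ->
  proj_map Ut f -> proj_holomorphic Ut f ->
  local_orthogonal Ut f ->
  null_map Ut f.
Proof.
move=> _ mm _ Uo Uc [p0 [Up0 [_ p00]]] [f0 _] fh fo.
have repr z : Ut z -> exists (rho : R) G, 0 < rho /\
    forall w, nrm (w - z) < 16 * rho -> [/\ Ut w, differentiable G w &
      exists2 mu : Cplx R, mu != 0 & f w = mu *: G w].
  move=> Uz; have [W [G [Wo Wz WG]]] := fh z Uz.
  have [d d0 dP] : exists2 d : R, 0 < d & forall y, nrm (y - z) < d -> (W `&` Ut) y.
    by apply: near_nrm; apply: open_nbhs_nbhs; split; [exact: openI|].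
  exists (d / 16), G; split; first lra.
  move=> w wz; have [|Ww Uw] := dP w; first lra.
  have [dG _ [mu fE]] := WG w Ww Uw; split => //; exists mu => //.
  by apply: contra_neq (f0 w Uw); rewrite fE => ->; rewrite scale0r.
have ident (x : 'rV[Cplx R]_(r' + s' + t')) (a : R) : 0 < a ->
    (forall w, nrm (w - p0) < a -> hform (f w) x = 0) ->
    forall z, Ut z -> hform (f z) x = 0.
  move=> a0 fx; apply: (connected_identity Uc); last by exists p0, a.
  move=> z /repr[rho [G [rho0 h]]].
  exists rho, (fun w => (G w *m hdual x) ord0 ord0); split => // w /h[Uw dG [mu mu0 fE]].
  split => //; first exact: differentiable_functional.
  rewrite /= -hform_mul fE hformZl; split=> [->|/eqP]; first by rewrite mulr0.
  by rewrite mulf_eq0 (negPf mu0) => /eqP.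
have [rho [G [rho0 h]]] := repr p0 Up0.
have sml w : nrm (w - p0) < rho -> nrm (w - p0) < 16 * rho by move=> *; lra.
have Gnull : forall z w, nrm (z - p0) < rho -> nrm (w - p0) < rho ->
    hform (G z) (G w) = 0.
  move=> z w zp wp.
  (* No orthogonality condition yet, the radical as null space of rank [t'], and one step more than
     the rank bound allows. *)
  apply: (@local_null R r s t r' s' t' G p0 rho _ _ mm (minn r' s').+1 [::]
    (radical_mx R r' s' t') p0 _ _ _ _ _ _ p00) => //.
  - by move=> u /h[].
  - move=> u v /sml/h[Uu _ [mu mu0 uE]] /sml/h[Uv _ [nu nu0 vE]] uv.
    have := fo u v Uu Uv uv; rewrite uE vE hformZl hformZr => /eqP.
    by rewrite !mulf_eq0 (negPf mu0) conjC_eq0 (negPf nu0) => /eqP.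
  - by rewrite radical_mx_rank.
  - by move=> u v _ vL; exact: hform_radical.
  - by move=> u l _ _; exact: hform_radical.
  - by rewrite subrr nrm0.
(* The first argument is extended to [Ut] with the second near [p0]; symmetry then frees the
   second. *)
have fnull1 w : nrm (w - p0) < rho -> forall z, Ut z -> hform (f z) (f w) = 0.
  move=> wp; apply: (ident _ rho) => // z zp.
  have [_ _ [mu mu0 ->]] := h z (sml z zp); have [_ _ [nu nu0 ->]] := h w (sml w wp).
  by rewrite hformZl hformZr Gnull// !mulr0.
have fnull w z : Ut w -> Ut z -> hform (f w) (f z) = 0.
  move=> Uw Uz; apply: (ident _ rho) Uw => // v vp.
  exact/hform_eq0C/fnull1.
have [X [XA AX]] := span_family [set f z | z in Ut].
exists <<X>>%VS; split; last by move=> z Uz; apply: AX; exists z.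
apply: null_span => u v /XA[z Uz <-] /XA[w Uw <-]; exact: fnull.
Qed.
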